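(* Let $(X,L)$ be a polarized toric variety with associated general system $(P,d\mu,d\sigma)$, let $\lambda\le0$ and $\xi\in\mathfrak{t}$. Then $(X,L)$ is toric $\mu^\lambda_\xi$K-semistable if and only if the linear function $\langle\cdot,\xi\rangle:P\to\mathbb{R}$ maximizes $\check{\mu}^\lambda_{\mathrm{NA}}$ on $\mathcal{E}^1(P)$, i.e. $\check{\mu}^\lambda_{\mathrm{NA}}(q)\le\check{\mu}^\lambda_{\mathrm{NA}}(\langle\cdot,\xi\rangle)$ for all $q\in\mathcal{E}^1(P)$.
   Context: Let $T\cong\mathbb{G}_m^n$ be an algebraic torus with character lattice $M$, $\mathfrak{t}^\vee:=M\otimes_{\mathbb{Z}}\mathbb{R}$ and $\mathfrak{t}$ its dual. For a polarized toric variety $(X,L)$ of dimension $n$, the associated general system $(P,d\mu,d\sigma)$ is: $P:=\mathrm{Conv}\{m\in M: H^0(X,L)_m\neq0\}\subset\mathfrak{t}^\vee$ (the moment lattice polytope, with non-empty interior); $d\mu$ the restriction to $P$ of the Lebesgue measure on $\mathfrak{t}^\vee$ normalized so that a fundamental domain of $M$ has volume $1$; $d\sigma$ the measure on $\partial P$ whose restriction to each facet $Q$ is the Lebesgue measure on the affine span $W$ of $Q$ normalized so that a fundamental domain of the lattice $W\cap M$ (translated) has volume $1$. $\mathcal{E}^1(P)$ denotes the set of lower semicontinuous convex functions $q:P\to(-\infty,\infty]$ with $\int_Pe^q\,d\mu<\infty$. For $q\in\mathcal{E}^1(P)$ put $\boldsymbol{\sigma}(q):=\frac{\int_P(n+q)e^q\,d\mu}{\int_Pe^q\,d\mu}-\log\int_Pe^q\,d\mu$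 and $\check{\mu}_{\mathrm{NA}}(q):=-2\pi\frac{\int_{\partial P}e^q\,d\sigma}{\int_Pe^q\,d\mu}\in[-\infty,0)$, and $\check{\mu}^\lambda_{\mathrm{NA}}(q):=\check{\mu}_{\mathrm{NA}}(q)+\lambda\boldsymbol{\sigma}(q)$ if $\boldsymbol{\sigma}(q)<\infty$, $\check{\mu}^\lambda_{\mathrm{NA}}(q):=-\infty$ otherwise. Write $\langle\cdot,\xi\rangle$ for the function $x\mapsto\langle x,\xi\rangle$ on $P$. For an integrable convex $q$ on $P$, the $\mu^\lambda_\xi$-Futaki invariant is $\mathrm{Fut}^\lambda_\xi(q):=\frac{2\pi\int_{\partial P}qe^{\langle\cdot,\xi\rangle}d\sigma-\lambda\int_Pq\langle\cdot,\xi\rangle e^{\langle\cdot,\xi\rangle}d\mu}{\int_Pe^{\langle\cdot,\xi\rangle}d\mu}-\bar{s}^\lambda_\xi\frac{\int_Pqe^{\langle\cdot,\xi\rangle}d\mu}{\int_Pe^{\langle\cdot,\xi\rangle}d\mu}$, where $\bar{s}^\lambda_\xi:=\frac{2\pi\int_{\partial P}e^{\langle\cdot,\xi\rangle}d\sigma-\lambda\int_P\langle\cdot,\xi\rangle e^{\langle\cdot,\xi\rangle}d\mu}{\int_Pe^{\langle\cdot,\xi\rangle}d\mu}$. $(X,L)$ is toric $\mu^\lambda_\xi$K-semistable if $\mathrm{Fut}^\lambda_\xi(q)\ge0$ for every rational piecewise affine convex function $q=\max_{i=1,\dots,m}\ell_i$ on $P$, with $\ell_i$ affine functions on $\mathfrak{t}^\vee$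 having rational linear part and rational constant term. *)

(* Defs.v *)
From mathcomp Require Import all_boot all_order all_algebra.
From mathcomp Require Import all_classical all_reals all_analysis.
Set Implicit Arguments. Unset Strict Implicit. Unset Printing Implicit Defensive.
Import Order.TTheory GRing.Theory Num.Theory numFieldNormedType.Exports.
Local Open Scope classical_set_scope.
Local Open Scope ring_scope.

Section Toric.
Variable R : realType.

(* pairing <x, xi> between t^vee = R^n and t = (R^n)^* (standard dual basis) *)
Definition dotv (n : nat) (x y : 'rV[R]_n) : R := \sum_(i < n) x 0 i * y 0 i.

Definition is_lattice (n : nat) (x : 'rV[R]_n) : Prop :=
  forall i, x 0 i \is a Num.int.

Definition conv_hull (n : nat) (S : seq 'rV[R]_n) : set 'rV[R]_n :=
  [set x | exists w : 'I_(size S) -> R,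
     (forall i, 0 <= w i) /\ \sum_(i < size S) w i = 1 /\
     x = \sum_(i < size S) w i *: S`_i].

Definition cons_rv (k : nat) (x0 : R) (y : 'rV[R]_k) : 'rV[R]_k.+1 :=
  \row_(i < k.+1) match unlift ord0 i with Some j => y 0 j | None => x0 end.

(* iterated Lebesgue integral over R^n (= integral for the product Lebesgue
   measure on R^n, normalised so that [0,1]^n has volume 1, for nonnegative
   measurable integrands by Tonelli) *)
Fixpoint iint (n : nat) : ('rV[R]_n -> \bar R) -> \bar R :=
  match n return ('rV[R]_n -> \bar R) -> \bar R with
  | 0 => fun f => f 0
  | k.+1 => fun f =>
      (\int[@lebesgue_measure R]_x iint (fun y => f (cons_rv x y)))%E
  end.

Definition leb_int (n : nat) (f : 'rV[R]_n -> \bar R) : \bar R :=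
  (iint (f^\+) - iint (f^\-))%E.

Definition int_P (n : nat) (P : set 'rV[R]_n) (g : 'rV[R]_n -> \bar R) : \bar R :=
  leb_int (fun x => if x \in P then g x else 0%E).

Definition is_facet (n : nat) (P Q : set 'rV[R]_n) : Prop :=
  exists (u : 'rV[R]_n) (c : R),
    u != 0 /\ (forall x, P x -> c <= dotv x u) /\
    Q = P `&` [set x | dotv x u = c] /\
    exists (x0 : 'rV[R]_n) (D : 'M[R]_(n.-1, n)),
      Q x0 /\ (forall i, Q (x0 + row i D)) /\ row_free D.

(* an affine lattice parametrisation t |-> p.1 + t p.2 of the affine span W of
   the facet Q: p.1 in W cap M and the rows of p.2 form a Z-basis of the
   lattice of integral vectors of the direction space of W *)
Definition lattice_param (n : nat) (Q : set 'rV[R]_n)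
    (p : 'rV[R]_n * 'M[R]_(n.-1, n)) : Prop :=
  is_lattice p.1 /\ (forall i j, p.2 i j \is a Num.int) /\ row_free p.2 /\
  (forall x, Q x -> exists t : 'rV[R]_(n.-1), x = p.1 + t *m p.2) /\
  (forall t : 'rV[R]_(n.-1), is_lattice (p.1 + t *m p.2) -> is_lattice t).

(* integral over the facet Q against the lattice-normalised Lebesgue measure
   of its affine span *)
Definition facet_int (n : nat) (Q : set 'rV[R]_n) (f : 'rV[R]_n -> \bar R) :
    \bar R :=
  let p := xget (0, 0) [set p | lattice_param Q p] in
  leb_int (fun t : 'rV[R]_(n.-1) =>
    let x := p.1 + t *m p.2 in if x \in Q then f x else 0%E).

Definition bd_int (n : nat) (P : set 'rV[R]_n) (f : 'rV[R]_n -> \bar R) : \bar R :=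
  (\sum_(Q \in [set Q | is_facet P Q]) facet_int Q f)%E.

Definition lsc_on (n : nat) (P : set 'rV[R]_n) (q : 'rV[R]_n -> \bar R) : Prop :=
  forall x, P x -> forall a : R, (a%:E < q x)%E ->
    \forall y \near x, P y -> (a%:E < q y)%E.

Definition convex_on (n : nat) (P : set 'rV[R]_n) (q : 'rV[R]_n -> \bar R) :
    Prop :=
  forall x y (t : R), P x -> P y -> 0 < t < 1 ->
    (q ((1 - t) *: x + t *: y)%R <= (1 - t)%:E * q x + t%:E * q y)%E.

Definition E1 (n : nat) (P : set 'rV[R]_n) (q : 'rV[R]_n -> \bar R) : Prop :=
  (forall x, P x -> q x != -oo%E) /\ lsc_on P q /\ convex_on P q /\
  (int_P P (fun x => expeR (q x)) < +oo)%E.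

Definition muNA (n : nat) (P : set 'rV[R]_n) (q : 'rV[R]_n -> \bar R) : \bar R :=
  ((- (2 * pi))%:E *
   (bd_int P (fun x => expeR (q x)) *
    ((fine (int_P P (fun x => expeR (q x))))^-1)%:E))%E.

Definition sigmaNA (n : nat) (P : set 'rV[R]_n) (q : 'rV[R]_n -> \bar R) : \bar R :=
  let Z := fine (int_P P (fun x => expeR (q x))) in
  (int_P P (fun x => ((n%:R)%:E + q x) * expeR (q x)) * (Z^-1)%:E
   - (ln Z)%:E)%E.

Definition muNA_lam (n : nat) (P : set 'rV[R]_n) (lam : R)
    (q : 'rV[R]_n -> \bar R) : \bar R :=
  if (sigmaNA P q < +oo)%E then (muNA P q + lam%:E * sigmaNA P q)%E else -oo%E.

Definition Fut (n : nat) (P : set 'rV[R]_n) (lam : R) (xi : 'rV[R]_n)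
    (q : 'rV[R]_n -> \bar R) : \bar R :=
  let e := fun x => expR (dotv x xi) in
  let Z := fine (int_P P (fun x => (e x)%:E)) in
  let sbar := (((2 * pi)%:E * bd_int P (fun x => (e x)%:E)
               - lam%:E * int_P P (fun x => (dotv x xi * e x)%:E)) * (Z^-1)%:E)%E in
  ((((2 * pi)%:E * bd_int P (fun x => q x * (e x)%:E)
     - lam%:E * int_P P (fun x => q x * (dotv x xi * e x)%:E)) * (Z^-1)%:E)
   - sbar * (int_P P (fun x => q x * (e x)%:E) * (Z^-1)%:E))%E.

Definition rpl (n m : nat) (a : 'I_m.+1 -> 'rV[rat]_n) (b : 'I_m.+1 -> rat)
    (x : 'rV[R]_n) : \bar R :=
  (\big[Order.max/-oo]_(i < m.+1) (dotv x (map_mx ratr (a i)) + ratr (b i))%:E)%E.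

Definition toric_semistable (n : nat) (P : set 'rV[R]_n) (lam : R)
    (xi : 'rV[R]_n) : Prop :=
  forall (m : nat) (a : 'I_m.+1 -> 'rV[rat]_n) (b : 'I_m.+1 -> rat),
    (0 <= Fut P lam xi (rpl a b))%E.

End Toric.

(* Main.v *)
(** Put [l := <., xi>], [e := exp l], [Z := \int_P e]. For [q] in [E1 P] write
    [e^q = g e]; then [g = exp (q - l)] is convex, lower semicontinuous and
    nonnegative, and if [q] is normalised by [\int_P e^q = Z] then
      [F(q) - F(l) = - Fut(g) + lam / Z * \int_P g (ln g) e],
    where [F] is the functional to be maximised. As [lam <= 0] and the entropy
    term is nonnegative, it suffices to extend [Fut >= 0] from rational
    piecewise affine functions to [g]: this is done by monotone convergence
    along an increasing sequence of maxima of rational affine minorants of [g].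
    Conversely, testing maximality on [q = l + t h] with [h] rational piecewise
    affine and [t -> 0+], the entropy term and the error [g - 1 - t h] are both
    [O(t^2)], so [Fut(h) >= 0]. The lattice structure of [P] enters only to make
    the boundary measure finite: every facet has a lattice parametrisation. *)

(* The obstacle is that [exp q] may be unbounded, even infinite on the boundary, while [Fut] is a
   difference of integrals and cannot be passed to the limit term by term. Adding a large constant
   [C] makes the weight [w = C - lam l - s] nonnegative, where [s] is the constant in [Fut]. For a
   minorant [h] of [g], [Fut(h) >= 0] then reads [C \int_P h e <= 2 pi \int_bd h e + \int_P w h e].
   The right side is at most its value for [exp q] by monotonicity alone, so monotone convergence is
   used only on the left and never on the boundary. Hence the two integrals enter through the few
   properties they share, collected in [posint]. Competitors are never normalised in the code: their
   total mass is carried along, and the inequality [1 + x <= exp x] absorbs the ratio of masses in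
   both directions. *)
From HB Require Import structures.
Require Import Defs.
From mathcomp Require Import all_boot all_order all_algebra.
From mathcomp Require Import all_classical all_reals all_analysis.
From mathcomp Require Import measurable_realfun ring lra.
Import Order.TTheory GRing.Theory Num.Theory numFieldNormedType.Exports.
Set Implicit Arguments. Unset Strict Implicit. Unset Printing Implicit Defensive.
Local Open Scope classical_set_scope.
Local Open Scope ring_scope.

(** * Lebesgue measure on row vectors *)

Section borel_rV.
Context {R : realType} (n : nat).
Let G : set (set 'rV[R]_n) := [set U | open U].
HB.instance Definition _ := @isMeasurable.Build (sigma_display G) 'rV[R]_n
  <<s G >> (@sigma_algebra0 _ setT G) (@sigma_algebraC _ G)
  (@sigma_algebra_bigcup _ setT G).
End borel_rV.

Lemma open_measurable_rV {R : realType} n (U : set 'rV[R]_n) :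
  open U -> measurable U.
Proof. by move=> oU; apply: sub_sigma_algebra. Qed.

Lemma closed_measurable_rV {R : realType} n (U : set 'rV[R]_n) :
  closed U -> measurable U.
Proof.
by move=> cU; rewrite -(setCK U); apply: measurableC;
  apply: open_measurable_rV; exact: closed_openC.
Qed.

Lemma ball_measurable_rV {R : realType} n (c : 'rV[R]_n) e :
  0 < e -> measurable (ball c e).
Proof. by move=> e0; apply: open_measurable_rV; exact: ball_open. Qed.

Lemma open_rV_bigcup_ball {R : realType} n (U : set 'rV[R]_n) : open U ->
  U = \bigcup_(p in [set p : 'rV[rat]_n * rat | 0 < p.2 /\
         ball (map_mx ratr p.1 : 'rV[R]_n) (ratr p.2) `<=` U])
       ball (map_mx ratr p.1 : 'rV[R]_n) (ratr p.2).
Proof.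
move=> oU; apply/seteqP; split=> [x Ux|x [[c r]] /= [r0 +] xcr]; last exact.
have /nbhs_ballP[e /= e0 eU] : nbhs x U by apply: open_nbhs_nbhs.
have e3 : e / 3 < e / 2.
  by rewrite ltr_pM2l// ltf_pV2 ?posrE// ltr_nat.
have [r] := rat_in_itvoo e3; rewrite in_itv /= => /andP[r1 r2].
have /choice[c cP] i : exists q : rat, ball (x 0 i) (e / 3) (ratr q).
  have : x 0 i - e / 3 < x 0 i + e / 3.
    by rewrite ltrD2l gt0_cp// divr_gt0.
  move=> /rat_in_itvoo[q]; rewrite in_itv /= => /andP[q1 q2]; exists q.
  by rewrite /ball/= ltr_distl; apply/andP; split; lra.
pose cc : 'rV[rat]_n := \row_i c i.
have r0 : 0 < ratr r :> R by apply: lt_trans r1; rewrite divr_gt0.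
have xc : ball x (e / 3) (map_mx ratr cc : 'rV[R]_n).
  split; first by rewrite divr_gt0.
  by move=> i j; rewrite ord1 !mxE; exact: cP.
exists (cc, r) => /=.
  split; first by rewrite -(ltr0q R).
  move=> y yc; apply: eU; apply: le_ball; last exact: ball_triangle xc yc.
  lra.
by apply: le_ball (ltW r1) _ _; exact: ball_sym.
Qed.

(** Rational balls form a countable base, so the preimage of an open set is a countable union of
    preimages of balls. *)
Lemma measurable_fun_rV d (T : measurableType d) {R : realType} n
    (f : T -> 'rV[R]_n) :
  (forall c e, 0 < e -> measurable (f @^-1` ball c e)) ->
  measurable_fun setT f.
Proof.
move=> mf; apply: (@measurability _ _ T ('rV[R]_n) setT f [set U | open U] erefl).
move=> _ [U /= oU <-]; rewrite setTI (open_rV_bigcup_ball oU) preimage_bigcup.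
rewrite bigcup_mkcond; apply: countable_bigcupT_measurable => // -[c r].
by case: ifPn => // /set_mem[/= r0 _]; apply: mf; rewrite ltr0q.
Qed.

Lemma continuous_measurable_rV {R : realType} n (f : 'rV[R]_n -> R)
    (D : set 'rV[R]_n) :
  continuous f -> measurable_fun D f.
Proof.
move=> cf; apply: measurable_funTS.
apply: (measurability _ (RGenOpens.measurableE R)) => //.
move=> _ [_ [a [b ->] <-]]; rewrite setTI.
apply: open_measurable_rV; apply: open_comp; first by move=> x _; exact: cf.
exact: interval_open.
Qed.

Lemma ball_cons_rv {R : realType} k (c : 'rV[R]_k.+1) e (x : R) (y : 'rV[R]_k) :
  0 < e -> ball c e (cons_rv x y) <->
  ball (c 0 0) e x /\ ball (\row_i c 0 (lift ord0 i)) e y.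
Proof.
move=> e0; split=> [[_ H]|[H1 [_ H2]]].
- split; first by have := H 0 0; rewrite mxE unlift_none.
  by split=> // i j; rewrite ord1 mxE; have := H 0 (lift ord0 j); rewrite mxE liftK.
- split=> // i j; rewrite ord1 mxE.
  case: unliftP => [j' ->|->]; last exact: H1.
  by have := H2 0 j'; rewrite mxE.
Qed.

Lemma measurable_cons_rv {R : realType} k :
  measurable_fun setT
    (fun p : measurableTypeR R * 'rV[R]_k => cons_rv p.1 p.2).
Proof.
apply: measurable_fun_rV => c e e0.
rewrite (_ : _ @^-1` _ = ball (c 0 0) e `*`
    (ball (\row_i c 0 (lift ord0 i)) e : set 'rV[R]_k)).
  by apply: measurableX; [exact: measurable_ball|exact: ball_measurable_rV].
by apply/seteqP; split=> -[x y]/=; move/(ball_cons_rv c x y e0).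
Qed.

(** Induction on the dimension: push the product of [lebesgue_measure] and the previous measure
    forward along [cons_rv], and apply Tonelli. The clause on balls is carried along because it
    yields the sigma-finiteness that the next product requires, and later the positive volume of [P]
    and finiteness on compact sets. *)
Lemma iint_measure (R : realType) n :
  exists mu : {sigma_finite_measure set 'rV[R]_n -> \bar R},
    (forall f : 'rV[R]_n -> \bar R, measurable_fun setT f ->
      (forall x, 0 <= f x)%E -> iint f = \int[mu]_x f x)%E /\
    (forall (x : 'rV[R]_n) e, 0 < e -> (0 < mu (ball x e) < +oo)%E).
Proof.
elim: n => [|k [mu [iE mub]]].
  pose d := @dirac _ 'rV[R]_0 0 R.
  exists d; split=> [f mf f0|x e e0] /=.
    by rewrite integral_dirac// diracT mul1e.
  rewrite /d diracE mem_set; first by rewrite lte01 ltry.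
  by split => // i [].
pose phi := fun p : measurableTypeR R * 'rV[R]_k => cons_rv p.1 p.2.
have mphi : measurable_fun setT phi by exact: measurable_cons_rv.
pose nu : {measure set 'rV[R]_k.+1 -> \bar R} :=
  measure_function_pushforward__canonical__measure_function_Measure
    (@lebesgue_measure R \x mu)%E mphi.
have nub (x : 'rV[R]_k.+1) e : 0 < e -> (0 < nu (ball x e) < +oo)%E.
  move=> e0; rewrite /nu/= /pushforward.
  rewrite (_ : _ @^-1` _ = ball (x 0 0) e `*`
      (ball (\row_i x 0 (lift ord0 i)) e : set 'rV[R]_k)); last first.
    by apply/seteqP; split=> -[a b]/=; move/(ball_cons_rv x a b e0).
  rewrite product_measure1E; [|exact: measurable_ball|exact: ball_measurable_rV].
  rewrite [X in (0 < X * _ < _)%E](_ : _ = (e *+ 2)%:E); last first.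
    exact/lebesgue_measure_ball/ltW.
  have /andP[m0 my] := mub (\row_i x 0 (lift ord0 i)) e e0.
  apply/andP; split; first by rewrite mule_gt0// lte_fin mulrn_wgt0.
  by rewrite lte_mul_pinfty// lee_fin mulrn_wge0// ltW.
have nusf : sigma_finite setT nu.
  exists (fun i => ball 0 (i.+1%:R)).
    apply/esym; rewrite -subTset => x _.
    exists (Num.trunc `|x|) => //=; rewrite -ball_normE /= sub0r normrN.
    exact: truncnS_gt.
  move=> i; split; first exact: ball_measurable_rV.
  by have /andP[] := nub 0 i.+1%:R (ltr0Sn _ _).
pose nu' : {sigma_finite_measure set 'rV[R]_k.+1 -> \bar R} :=
  HB.pack (Measure.sort nu) (Measure_isSigmaFinite.Build _ _ _ nu nusf).
exists nu'; split=> // f mf f0 /=.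
rewrite ge0_integral_pushforward//= fubini_tonelli1//=; last first.
  exact: measurableT_comp.
apply: eq_integral => x _; rewrite iE//.
apply: (measurableT_comp mf).
by have := measurableT_comp mphi (pair1_measurable x); apply.
Qed.

Definition lebm (R : realType) n :
    {sigma_finite_measure set 'rV[R]_n -> \bar R} :=
  sval (cid (iint_measure R n)).

Lemma iint_lebm {R : realType} n (f : 'rV[R]_n -> \bar R) :
  measurable_fun setT f -> (forall x, 0 <= f x)%E ->
  iint f = (\int[lebm R n]_x f x)%E.
Proof. exact: (svalP (cid (iint_measure R n))).1. Qed.

Lemma lebm_ball {R : realType} n (x : 'rV[R]_n) e :
  0 < e -> (0 < lebm R n (ball x e) < +oo)%E.
Proof. exact: (svalP (cid (iint_measure R n))).2. Qed.

Lemma leb_intE {R : realType} n (f : 'rV[R]_n -> \bar R) :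
  measurable_fun setT f -> leb_int f = (\int[lebm R n]_x f x)%E.
Proof.
move=> mf; rewrite /leb_int integralE.
rewrite !iint_lebm//; first exact: measurable_funeneg.
exact: measurable_funepos.
Qed.

Lemma leb_int_mask {R : realType} n (D : set 'rV[R]_n) (f : 'rV[R]_n -> \bar R) :
  measurable D -> measurable_fun D f ->
  leb_int (fun x => if x \in D then f x else 0%E) = (\int[lebm R n]_(x in D) f x)%E.
Proof.
move=> mD mf; rewrite integral_mkcond leb_intE//.
exact/(measurable_restrictT _ mD).
Qed.

(** * Integration over [P] and over its boundary as monotone functionals *)

Section posint.
Context {R : realType} {n : nat}.
Implicit Types (P : set 'rV[R]_n) (B : ('rV[R]_n -> \bar R) -> \bar R).

Definition bdd_on P (f : 'rV[R]_n -> R) := exists M, forall x, P x -> `|f x| <= M.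

(** Monotonicity is asked of nonnegative functions with values in [\bar R], so that it applies to
    [exp q]; finiteness and linearity are asked only of bounded real functions. *)
Record posint P B : Prop := PosInt {
  posint_ext : forall f g, (forall x, P x -> f x = g x) -> B f = B g ;
  posint_ge0 : forall f, measurable_fun P f -> (forall x, P x -> 0 <= f x)%E ->
    (0 <= B f)%E ;
  posint_le : forall f g, measurable_fun P f -> measurable_fun P g ->
    (forall x, P x -> 0 <= f x)%E -> (forall x, P x -> f x <= g x)%E ->
    (B f <= B g)%E ;
  posint_fin : forall f, measurable_fun P f -> bdd_on P f ->
    B (fun x => (f x)%:E) \is a fin_num ;
  posint_lin : forall a f g, measurable_fun P f -> bdd_on P f ->
    measurable_fun P g -> bdd_on P g ->
    B (fun x => (a * f x + g x)%:E) =
    (a%:E * B (fun x => (f x)%:E) + B (fun x => (g x)%:E))%E }.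

Lemma posint0 P : posint P (fun=> 0%E).
Proof. by split => // *; rewrite mule0 adde0. Qed.

Lemma posintD P B1 B2 : posint P B1 -> posint P B2 ->
  posint P (fun f => B1 f + B2 f)%E.
Proof.
move=> p1 p2; split.
- by move=> f g fg; rewrite (posint_ext p1 fg) (posint_ext p2 fg).
- by move=> f mf f0; rewrite adde_ge0// ?(posint_ge0 p1)// (posint_ge0 p2).
- by move=> f g *; rewrite leeD// ?(posint_le p1)// (posint_le p2).
- by move=> f *; rewrite fin_numD ?(posint_fin p1)// ?(posint_fin p2).
- move=> a f g mf bf mg bg; rewrite (posint_lin p1)// (posint_lin p2)//.
  rewrite muleDr//; last by rewrite fin_num_adde_defr// (posint_fin p1).
  by rewrite addeACA.
Qed.

(** One model for both integrals: [phi = id] on [P] yields [int_P], an affine parametrisation of a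
    facet yields [facet_int]. *)
Lemma posint_integral k (mu : {measure set 'rV[R]_k -> \bar R})
    (D : set 'rV[R]_k) (phi : 'rV[R]_k -> 'rV[R]_n) P :
  measurable D -> (mu D < +oo)%E -> measurable P -> measurable_fun D phi ->
  (forall t, D t -> P (phi t)) ->
  posint P (fun f => \int[mu]_(t in D) f (phi t))%E.
Proof.
move=> mD muD mP mphi DP.
have mc d (T : measurableType d) (f : 'rV[R]_n -> T) :
    measurable_fun P f -> measurable_fun D (fun t => f (phi t)).
  by move=> mf; apply: (measurable_comp mP _ mf mphi) => _ [t Dt <-]; exact: DP.
have ib (f : 'rV[R]_n -> R) : measurable_fun P f -> bdd_on P f ->
    mu.-integrable D (fun t => (f (phi t))%:E).
  move=> mf [M fM]; apply: measurable_bounded_integrable => //; first exact: mc.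
  exists M; split; first by rewrite num_real.
  by move=> x Mx t Dt; apply: le_trans (ltW Mx); exact/fM/DP.
split.
- by move=> f g fg; apply: eq_integral => t /set_mem Dt; exact/fg/DP.
- by move=> f mf f0; apply: integral_ge0 => t Dt; exact/f0/DP.
- move=> f g mf mg f0 fg; apply: ge0_le_integral => //.
  + by move=> t Dt; exact/f0/DP.
  + exact: mc.
  + exact: mc.
  + by move=> t Dt; exact/fg/DP.
- by move=> f mf bf; apply: integrable_fin_num => //; exact: ib.
- move=> a f g mf bf mg bg.
  rewrite -(integralZl mD (ib f mf bf) a).
  transitivity (\int[mu]_(t in D) (a%:E * (f (phi t))%:E + (g (phi t))%:E))%E.
    by apply: eq_integral => t _; rewrite EFinD EFinM.
  rewrite (integralD mD)//; last exact: ib.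
  by apply: (integrableZl mD a); exact: ib.
Qed.

(** [int_P] and [facet_int] are identified with integrals against a measure only for measurable
    integrands, whereas [posint_ext] ranges over all functions; hence the separate extensionality
    hypothesis. *)
Lemma eq_posint P B1 B2 : posint P B1 ->
  (forall f, measurable_fun P f -> B2 f = B1 f) ->
  (forall f g, (forall x, P x -> f x = g x) -> B2 f = B2 g) -> posint P B2.
Proof.
move=> p1 B21 ext; split=> //.
- by move=> f mf f0; rewrite B21//; exact: (posint_ge0 p1).
- by move=> f g mf mg f0 fg; rewrite !B21//; exact: (posint_le p1).
- by move=> f mf bf; rewrite B21 ?(posint_fin p1)//; exact/measurable_EFinP.
- move=> a f g mf bf mg bg; rewrite !B21 ?(posint_lin p1)//;
    apply/measurable_EFinP => //.
  by apply: measurable_funD => //; exact: measurable_funM.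
Qed.

Lemma posint_int_P P : measurable P -> (lebm R n P < +oo)%E ->
  posint P (int_P P).
Proof.
move=> mP Poo; apply: (eq_posint (@posint_integral n _ P id P mP Poo mP _ _)) => //.
- by move=> f mf; rewrite /int_P leb_int_mask.
- move=> f g fg; rewrite /int_P; congr leb_int; apply/funext => x.
  by case: ifPn => // /set_mem /fg.
Qed.

End posint.

(** * Polytopes and their facets *)

Lemma continuous_sum {R : realType} (T : topologicalType) (V : normedModType R)
    N (f : 'I_N -> T -> V) :
  (forall i, continuous (f i)) -> continuous (fun x => \sum_i f i x).
Proof.
move=> cf; elim: (index_enum _) => [|i r IHr] x.
  by under eq_fun do rewrite big_nil; exact: cvg_cst.
under eq_fun do rewrite big_cons.
by apply: continuousD; [exact: cf|exact: IHr].
Qed.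

Lemma ler_coord_norm {R : realType} n (x : 'rV[R]_n) i : `|x 0 i| <= `|x|.
Proof.
rewrite [leRHS]/Num.norm /= mx_normrE.
by apply/bigmax_geP; right => /=; exists (0, i).
Qed.

Section dotv.
Context {R : realType} {n : nat}.
Implicit Types x y u : 'rV[R]_n.

Lemma dotvDl x y u : dotv (x + y) u = dotv x u + dotv y u.
Proof. by rewrite /dotv -big_split; apply: eq_bigr => i _; rewrite mxE mulrDl. Qed.

Lemma dotvZl a x u : dotv (a *: x) u = a * dotv x u.
Proof. by rewrite /dotv mulr_sumr; apply: eq_bigr => i _; rewrite mxE mulrA. Qed.

Lemma dotvBl x y u : dotv (x - y) u = dotv x u - dotv y u.
Proof. by rewrite -scaleN1r dotvDl dotvZl mulN1r. Qed.

Lemma dotvC x y : dotv x y = dotv y x.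
Proof. by apply: eq_bigr => i _; rewrite mulrC. Qed.

Lemma dotv0l u : dotv 0 u = 0.
Proof. by rewrite /dotv big1// => i _; rewrite mxE mul0r. Qed.

Lemma dotv_suml N (w : 'I_N -> R) (s : 'I_N -> 'rV[R]_n) u :
  dotv (\sum_i w i *: s i) u = \sum_i w i * dotv (s i) u.
Proof.
by elim/big_ind2 : _ => [|x1 x2 y1 y2 <- <-|i _]; rewrite ?dotv0l ?dotvDl ?dotvZl.
Qed.

Lemma dotv_mx x u : dotv x u = (x *m u^T) 0 0.
Proof. by rewrite mxE; apply: eq_bigr => i _; rewrite mxE. Qed.

Lemma dotv_norm x u : `|dotv x u| <= n%:R * (`|x| * `|u|).
Proof.
apply: (le_trans (ler_norm_sum _ _ _)).
apply: (@le_trans _ _ (\sum_(i < n) `|x| * `|u|)).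
  by apply: ler_sum => i _; rewrite normrM ler_pM// ler_coord_norm.
by rewrite sumr_const card_ord mulr_natl.
Qed.

Lemma dotv_continuous u : continuous (fun x => dotv x u).
Proof.
apply: (@continuous_sum R 'rV[R]_n R^o n (fun i y => y 0 i * u 0 i)) => i x.
exact: (cvgMr_tmp (b := u 0 i) (@coord_continuous R 1 n 0 i x)).
Qed.

End dotv.

Lemma mulmx_continuous {R : realType} m n (B : 'M[R]_(m, n)) :
  continuous (fun t : 'rV[R]_m => t *m B).
Proof.
under eq_fun do rewrite mulmx_sum_row.
apply: (@continuous_sum R 'rV[R]_m 'rV[R]_n m (fun i y => y 0 i *: row i B)) => i x.
exact: (cvgZr_tmp (a := row i B) (@coord_continuous R 1 m 0 i x)).
Qed.

Lemma continuous_rV_measurable {R : realType} m n (f : 'rV[R]_m -> 'rV[R]_n)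
    (D : set 'rV[R]_m) : continuous f -> measurable_fun D f.
Proof.
move=> cf; apply: measurable_funTS; apply: measurable_fun_rV => c e e0.
apply: open_measurable_rV; apply: open_comp; last exact: ball_open.
by move=> x _; exact: cf.
Qed.

Section hull.
Context {R : realType} {n : nat} (S : seq 'rV[R]_n).
Local Notation P := (conv_hull S).

Lemma conv_hull_convex x y t : P x -> P y -> 0 <= t <= 1 ->
  P ((1 - t) *: x + t *: y).
Proof.
move=> [v [v0 [v1 ->]]] [w [w0 [w1 ->]]] /andP[t0 t1].
exists (fun i => (1 - t) * v i + t * w i); split; [|split].
- by move=> i; rewrite addr_ge0// mulr_ge0// subr_ge0.
- by rewrite big_split -!mulr_sumr /= v1 w1 !mulr1 subrK.
- by rewrite !scaler_sumr -big_split /=; apply: eq_bigr => i _; rewrite !scalerA -scalerDl.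
Qed.

(** The hull is the linear image of the standard simplex, a closed subset of a cube. *)
Lemma compact_conv_hull : compact P.
Proof.
pose D := [set w : 'rV[R]_(size S) | forall i, `[0, 1]%classic (w ord0 i)] `&`
  [set w | \sum_i w 0 i = 1].
rewrite (_ : P = (fun w : 'rV[R]_(size S) =>
    w *m (\matrix_(i < size S) S`_i)) @` D); last first.
  apply/seteqP; split=> [x [w [w0 [w1 ->]]]|_ [w [/= w0 w1] <-]].
    exists (\row_i w i); last first.
      by rewrite mulmx_sum_row; apply: eq_bigr => i _; rewrite mxE rowK.
    split=> /=; last by under eq_bigr do rewrite mxE.
    move=> i; rewrite /= mxE in_itv /= w0/= -w1 (bigD1 i)//= lerDl.
    by apply: sumr_ge0.
  exists (w 0); split; first by move=> i; have := w0 i; rewrite /= in_itv => /andP[].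
  by split=> //; rewrite mulmx_sum_row; apply: eq_bigr => i _; rewrite rowK.
apply: continuous_compact; first exact/continuous_subspaceT/mulmx_continuous.
apply: compact_closedI.
  apply: (@rV_compact R (size S) (fun=> `[0, 1]%classic)) => _.
  exact: segment_compact.
change (closed ((fun w : 'rV[R]_(size S) => \sum_i w 0 i) @^-1` [set (1 : R^o)])).
apply: closed_comp; last exact: closed_eq.
move=> x _; move: x.
apply: (@continuous_sum R 'rV[R]_(size S) R^o _ (fun i y => y 0 i)) => i y.
exact: (@coord_continuous R 1 _ 0 i y).
Qed.

Lemma measurable_conv_hull : measurable P.
Proof.
apply: closed_measurable_rV; apply: compact_closed compact_conv_hull.
exact: norm_hausdorff.
Qed.

End hull.

Lemma compact_bound {R : realType} n (A : set 'rV[R]_n) : compact A ->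
  exists2 M, 0 < M & forall x, A x -> `|x| <= M.
Proof.
move=> /compact_bounded[M [_ MA]]; exists (`|M| + 1); first by rewrite ltr_wpDl.
by move=> x Ax; apply: (MA (`|M| + 1)) => //; rewrite (le_lt_trans (ler_norm M))// ltrDl.
Qed.

Lemma lebm_compact {R : realType} n (A : set 'rV[R]_n) : compact A ->
  (lebm R n A < +oo)%E.
Proof.
move=> cA; have [M M0 AM] := compact_bound cA.
have M1 : 0 < M + 1 by rewrite addr_gt0.
have /andP[_] := lebm_ball (0 : 'rV[R]_n) M1.
apply: le_lt_trans; apply: le_measure; rewrite ?inE.
- by apply: closed_measurable_rV; apply: compact_closed cA; exact: norm_hausdorff.
- exact: ball_measurable_rV.
- by move=> x /AM xM; rewrite -ball_normE /= sub0r normrN (le_lt_trans xM)// ltrDl.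
Qed.

Section facets.
Context {R : realType} {n : nat} (S : seq 'rV[R]_n).
Local Notation P := (conv_hull S).

Lemma mem_conv_hull (i : 'I_(size S)) : P S`_i.
Proof.
exists (fun j => (j == i)%:R); split; first by move=> j; rewrite ler0n.
split.
  by rewrite (bigD1 i)//= eqxx big1 ?addr0// => j /negPf ->.
rewrite (bigD1 i)//= eqxx scale1r big1 ?addr0// => j /negPf ->.
by rewrite scale0r.
Qed.

(** The numbers [w_j (<s_j, u> - c)] are nonnegative and sum to zero, so each of them vanishes. *)
Lemma supporting_weights (u : 'rV[R]_n) c (w : 'I_(size S) -> R) :
  (forall x, P x -> c <= dotv x u) -> (forall i, 0 <= w i) -> \sum_i w i = 1 ->
  dotv (\sum_i w i *: S`_i) u = c ->
  forall i, w i != 0 -> dotv S`_i u = c.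
Proof.
move=> cP w0 w1; rewrite dotv_suml => wc i wi.
have h j : 0 <= w j * (dotv S`_j u - c).
  by rewrite mulr_ge0// subr_ge0; exact/cP/mem_conv_hull.
have : \sum_j w j * (dotv S`_j u - c) = 0.
  under eq_bigr do rewrite mulrBr.
  by rewrite sumrB wc -mulr_suml w1 mul1r subrr.
move/psumr_eq0P => /(_ (fun j _ => h j)) /(_ i isT)/eqP.
by rewrite mulf_eq0 (negbTE wi)/= subr_eq0 => /eqP.
Qed.

(** A facet is the hull of the generators lying on it, so it is determined by a subset of a finite
    index set. This turns [bd_int] into an ordinary finite sum. *)
Lemma finite_facets : finite_set [set Q | is_facet P Q].
Proof.
pose F (B : {set 'I_(size S)}) := [set x | exists w : 'I_(size S) -> R,
  [/\ forall i, 0 <= w i, \sum_i w i = 1, forall i, i \notin B -> w i = 0 &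
      x = \sum_i w i *: S`_i]].
apply: (@sub_finite_set _ _ (F @` setT)).
  move=> Q [u [c [_ [cP [-> _]]]]].
  exists (finset (fun i : 'I_(size S) => dotv S`_i u == c)) => //.
  apply/seteqP; split=> [x [w [w0 w1 wB ->]]|x [[w [w0 [w1 xE]]] /= xc]].
    split; first by exists w.
    rewrite /= dotv_suml -[RHS]mul1r -w1 mulr_suml; apply: eq_bigr => i _.
    have [/eqP -> //|ic] := boolP (dotv S`_i u == c).
    by rewrite wB ?inE// !mul0r.
  exists w; split=> // i; rewrite inE; apply: contraNeq => wi.
  by apply/eqP; apply: (supporting_weights cP w0 w1) => //; rewrite -xE.
exact/finite_image/finite_finset.
Qed.

End facets.

Lemma mulmx_row' {R : realType} k (j : 'I_k.+1) (z : 'rV[R]_k.+1)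
    (A : 'M[R]_k.+1) :
  z 0 j = 0 -> z *m A = col' j z *m row' j A.
Proof.
move=> zj; rewrite !mulmx_sum_row (bigD1_ord j)//= zj scale0r add0r.
apply: eq_bigr => i _; rewrite mxE; congr (_ *: _).
by apply/rowP => l; rewrite !mxE.
Qed.

Lemma lattice_mulmx_int {R : realType} m k (z : 'rV[R]_m) (A : 'M[int]_(m, k)) :
  is_lattice z -> is_lattice (z *m map_mx intr A).
Proof.
move=> zi i; rewrite mxE; apply: rpred_sum => l _.
by rewrite mxE rpredM ?zi// intr_int.
Qed.

(* The rows of [N] below are the edge vectors from a vertex of [Q]; the Smith
   normal form turns their span into the span of all but one row of a
   unimodular matrix. *)
Lemma lattice_param_exists {R : realType} k (S : seq 'rV[R]_k.+1)
    (HS : forall s, s \in S -> is_lattice s) Q :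
  is_facet (conv_hull S) Q -> exists p, lattice_param Q p.
Proof.
move=> [u [c [u0 [cP [QE [x0 [_ [Qx0 _]]]]]]]].
have SL (i : 'I_(size S)) : is_lattice S`_i by apply/HS/mem_nth.
have [i0 i0c] : exists i : 'I_(size S), dotv S`_i u = c.
  move: Qx0; rewrite QE => -[[w [w0 [w1 xE]]] /= xc].
  have [i wi] : exists i, w i != 0.
    apply/not_existsP => wz; move/eqP: w1; rewrite big1 ?(eq_sym 0) ?oner_eq0//.
    by move=> i _; apply/eqP; apply/negPn/negP; exact: wz.
  by exists i; apply: (supporting_weights cP w0 w1) => //; rewrite -xE.
(* Generators off [Q] contribute a zero row, which keeps the index type; [Num.floor] merely
   transports integral entries to [int]. *)
pose N : 'M[int]_(size S, k.+1) := \matrix_(i, l)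
  if dotv S`_i u == c then Num.floor ((S`_i - S`_i0) 0 l) else 0.
pose NR : 'M[R]_(size S, k.+1) := map_mx intr N.
have NE (i : 'I_(size S)) : dotv S`_i u = c ->
    row i NR = S`_i - S`_i0.
  move=> ic; apply/rowP => l; rewrite !mxE ic eqxx floorK//.
  by rewrite rpredB ?SL.
have NZ (i : 'I_(size S)) : dotv S`_i u != c -> row i NR = 0.
  by move=> ic; apply/rowP => l; rewrite !mxE (negbTE ic).
have QN x : Q x -> exists y : 'rV[R]_(size S), x = S`_i0 + y *m NR.
  rewrite QE => -[[w [w0 [w1 xE]]] /= xc]; exists (\row_i w i).
  rewrite mulmx_sum_row -[S`_i0]scale1r -w1 scaler_suml -big_split/= {1}xE.
  apply: eq_bigr => i _; rewrite mxE.
  have [->|wi] := eqVneq (w i) 0; first by rewrite !scale0r addr0.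
  rewrite NE ?scalerBr 1?addrC ?subrK//.
  by apply: (supporting_weights cP w0 w1) => //; rewrite -xE.
have Nu : NR *m u^T = 0.
  apply/row_matrixP => i; rewrite row_mul row0.
  have [ic|ic] := eqVneq (dotv S`_i u) c; last by rewrite NZ// mul0mx.
  apply/rowP => l; rewrite ord1 NE// -dotv_mx dotvBl ic i0c subrr mxE//.
have [L uL [U uU [d _ NLU]]] := int_Smith_normal_form N.
set Dg := \matrix_(i, j) _ in NLU.
pose LR : 'M[R]_(size S) := map_mx intr L.
pose UR : 'M[R]_k.+1 := map_mx intr U.
pose DR : 'M[R]_(size S, k.+1) := map_mx intr Dg.
have uLR : LR \in unitmx by rewrite unitmxE det_map_mx rmorph_unit// -unitmxE.
have uUR : UR \in unitmx by rewrite unitmxE det_map_mx rmorph_unit// -unitmxE.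
have NRE : NR = LR *m DR *m UR.
  by rewrite /NR NLU !map_mxM.
(* The entries of [v] are the pairings of the rows of [UR] with the normal [u]. [v] is nonzero since
   [UR] is invertible, and [DR *m v = 0] since [u] kills the edges. So column [j] of the diagonal
   [DR] vanishes when [v_j] does not, and row [j] of [UR] is the one to drop. *)
pose v : 'cV[R]_k.+1 := UR *m u^T.
have [j vj] : exists j, v j 0 != 0.
  apply/not_existsP => vz; move/negP: u0; apply.
  have : v = 0.
    apply/colP => j; rewrite [RHS]mxE; apply/eqP; apply/negPn/negP; exact: vz.
  rewrite /v => /(congr1 (mulmx (invmx (UR)))).
  by rewrite mulKmx// mulmx0 => /eqP; rewrite trmx_eq0.
have Dv : DR *m v = 0.
  move: Nu; rewrite NRE -!mulmxA => /(congr1 (mulmx (invmx (LR)))).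
  by rewrite mulKmx// mulmx0.
have Dj (i : 'I_(size S)) : DR i j = 0 :> R.
  rewrite !mxE; have [ij|_] := eqVneq (i : nat) (j : nat); last by rewrite mulr0n.
  have := congr1 (fun M : 'cV[R]__ => M i 0) Dv.
  rewrite [RHS]mxE mxE (bigD1 j)//= big1 ?addr0; last first.
    move=> l lj; rewrite !mxE ij eq_sym val_eqE (negbTE lj) mulr0n.
    by rewrite mul0r.
  rewrite !mxE ij eqxx => /eqP; rewrite mulf_eq0 => /orP[/eqP//|].
  by move: vj; rewrite mxE => /negbTE ->.
exists (S`_i0, row' j (UR)); split; first exact: SL.
split; first by move=> a b; rewrite /= !mxE intr_int.
(* Facet coordinates are coordinates in the basis [UR] with entry [j] equal to zero; integrality is
   then read off through the integral inverse of [U]. *)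
pose ins (t : 'rV[R]_k) : 'rV[R]_k.+1 :=
  \row_i (if unlift j i is Some i' then t 0 i' else 0).
have insj t : ins t 0 j = 0 by rewrite mxE unlift_none.
have insc t : col' j (ins t) = t.
  by apply/rowP => i; rewrite !mxE liftK.
have insE t : t *m row' j (UR) = ins t *m UR.
  by rewrite (mulmx_row' _ (insj t)) insc.
split.
  apply: inj_row_free => t; rewrite /= insE.
  move/(congr1 (mulmxr (invmx (UR)))).
  by rewrite /= mulmxK// mul0mx -{2}(insc t) => ->; apply/rowP => i; rewrite !mxE.
split=> [x /QN[y ->]|t /= tL].
  exists (col' j (y *m LR *m DR)).
  rewrite NRE !mulmxA -mulmx_row'// mxE big1// => i _.
  by rewrite Dj mulr0.
have : is_lattice (ins t *m UR).
  move=> i; rewrite -insE.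
  have -> : t *m row' j (UR) =
    (S`_i0 + t *m row' j (UR)) - S`_i0 by rewrite addrAC subrr add0r.
  by rewrite mxE rpredD ?tL// mxE rpredN SL.
move/(@lattice_mulmx_int _ _ _ _ (invmx U)); rewrite -mulmxA -map_mxM mulmxV// map_mx1 mulmx1.
by move=> H i; have := H (lift j i); rewrite mxE liftK.
Qed.

Lemma posint_facetS {R : realType} k (S : seq 'rV[R]_k.+1)
    (HS : forall s, s \in S -> is_lattice s) Q :
  is_facet (conv_hull S) Q -> posint (conv_hull S) (facet_int Q).
Proof.
move=> fQ; set P := conv_hull S.
have [QP cQ] : Q `<=` P /\ compact Q.
  have [u [c [_ [_ [-> _]]]]] := fQ; split; first by move=> x [].
  apply: compact_closedI; first exact: compact_conv_hull.
  change (closed ((fun x : 'rV[R]_k.+1 => dotv x u) @^-1` [set (c : R^o)])).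
  apply: closed_comp; last exact: closed_eq.
  by move=> x _; exact: dotv_continuous.
have [p0 lp0] := lattice_param_exists HS fQ.
(* Had no lattice parametrisation existed, [xget] would return [(0, 0)], [phi] would be constant and
   its domain [D] could be the whole space. *)
pose p := xget (0, 0) [set p | lattice_param Q p].
have [_ [_ [p2free _]]] : lattice_param Q p.
  by apply: (xgetPex (0, 0) (P := [set p | lattice_param Q p])); exists p0.
pose phi (t : 'rV[R]_k) := p.1 + t *m p.2.
have cphi : continuous phi.
  move=> t; apply: (@continuousD R 'rV[R]_k.+1 'rV[R]_k (fun=> p.1)
    (fun t => t *m p.2) t); [exact: cst_continuous|exact: mulmx_continuous].
pose D := phi @^-1` Q.
have mQ : measurable Q.
  by apply: closed_measurable_rV; apply: compact_closed cQ; exact: norm_hausdorff.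
have mD : measurable D.
  by rewrite -[D]setTI; apply: (continuous_rV_measurable cphi).
have muD : (lebm R k D < +oo)%E.
  (* [psi] is a left inverse of [phi], so [D] lies in the compact set [psi @] applied to [Q] and has
     finite measure. *)
  pose psi (x : 'rV[R]_k.+1) := (x - p.1) *m pinvmx p.2.
  have cE : compact (psi @` Q).
    apply: continuous_compact cQ; apply: continuous_subspaceT.
    move=> x; apply: (@continuous_comp 'rV[R]_k.+1 'rV[R]_k.+1 'rV[R]_k (fun x => x - p.1)
      (fun x => x *m pinvmx p.2)).
      apply: (@continuousB R 'rV[R]_k.+1 'rV[R]_k.+1 id (fun=> p.1) x).
        exact: cvg_id.
      exact: cst_continuous.
    exact: mulmx_continuous.
  apply: le_lt_trans (lebm_compact cE); apply: le_measure; rewrite ?inE//.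
    apply: closed_measurable_rV; apply: compact_closed cE; exact: norm_hausdorff.
  move=> t Dt; exists (phi t) => //.
  by rewrite /psi /phi addrAC subrr add0r mulmxKp.
have pI : posint P (fun f => \int[lebm R k]_(t in D) f (phi t))%E.
  apply: posint_integral => //; first exact: measurable_conv_hull.
    exact: continuous_rV_measurable.
  by move=> t /QP.
apply: (eq_posint pI).
- move=> f mf; rewrite /facet_int -/p.
  apply: (@leb_int_mask R k D (fun t => f (phi t))) => //.
  apply: (measurable_comp (measurable_conv_hull S) _ mf).
    by move=> _ [t /QP Pt <-].
  exact: continuous_rV_measurable.
- move=> f g fg; rewrite /facet_int; congr leb_int; apply/funext => t /=.
  by case: ifPn => // /set_mem/QP/fg.
Qed.

(** For [n = 0] no normal vector is nonzero, so there is no facet; otherwise [n.-1] is a genuine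
    predecessor. *)
Lemma posint_facet {R : realType} n (S : seq 'rV[R]_n)
    (HS : forall s, s \in S -> is_lattice s) Q :
  is_facet (conv_hull S) Q -> posint (conv_hull S) (facet_int Q).
Proof.
case: n S HS Q => [S HS Q [u [c [/negP[]]]]|k S HS Q]; last exact: posint_facetS.
by apply/eqP/rowP => -[].
Qed.

Lemma posint_bd_int {R : realType} n (S : seq 'rV[R]_n)
    (HS : forall s, s \in S -> is_lattice s) :
  posint (conv_hull S) (bd_int (conv_hull S)).
Proof.
pose A := [set Q | is_facet (conv_hull S) Q].
pose s : seq (set 'rV[R]_n) := finmap.enum_fset (fset_set A).
rewrite (_ : bd_int _ = fun f => (\sum_(Q <- s) facet_int Q f)%E); last first.
  by apply/funext => f; rewrite /bd_int fsbig_finite//; exact: finite_facets.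
have : forall Q, Q \in s -> posint (conv_hull S) (facet_int Q).
  move=> Q Qs; have : Q \in A by rewrite -(in_fset_set (finite_facets S)).
  by rewrite inE; exact: posint_facet.
elim: s => [|Q s IHs] sP.
  rewrite (_ : (fun f => _) = fun=> 0%E); first exact: posint0.
  by apply/funext => f; rewrite big_nil.
rewrite (_ : (fun f => _) = fun f =>
    (facet_int Q f + \sum_(Q <- s) facet_int Q f)%E); last first.
  by apply/funext => f; rewrite big_cons.
apply: posintD; first by apply: sP; rewrite inE eqxx.
by apply: IHs => Q' Q's; apply: sP; rewrite inE Q's orbT.
Qed.

(** * Affine minorants of convex functions *)

Section minorants.
Context {R : realType} {n : nat}.
Implicit Types (P : set 'rV[R]_n) (f g : 'rV[R]_n -> \bar R).

Lemma lsc_compact_min P f : compact P -> lsc_on P f ->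
  (forall x, P x -> 0 <= f x)%E -> (exists2 x, P x & (f x < +oo)%E) ->
  exists2 y, P y & f y \is a fin_num /\ forall x, P x -> (f y <= f x)%E.
Proof.
move=> /compact_near_coveringP cP lf f0 [x0 Px0 fx0].
have [m mE] : exists m : R, ereal_inf (f @` P) = m%:E.
  have : ereal_inf (f @` P) \is a fin_num.
    rewrite fin_numElt; apply/andP; split.
      apply: (@lt_le_trans _ _ 0%E) => //.
      by apply: le_ereal_inf_tmp => _ [x Px <-]; exact: f0.
    by apply: le_lt_trans fx0; apply: ereal_inf_lbound; exists x0.
  by move=> /fineK <-; eexists.
have mf x : P x -> (m%:E <= f x)%E.
  by move=> Px; rewrite -mE; apply: ereal_inf_lbound; exists x.
suff [y Py fy] : exists2 y, P y & f y = m%:E.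
  by exists y => //; rewrite fy; split=> // x; exact: mf.
apply: contrapT => /forall2NP nf.
have fm x : P x -> (m%:E < f x)%E.
  by move=> Px; rewrite lt_neqAle mf// andbT; apply/eqP => /esym; case: (nf x).
(* If the infimum [m] were not attained, each point would have a neighbourhood on which [f] exceeds
   some [a > m]; compactness makes a single [i > m] serve all of [P]. *)
have : \forall i \near m^'+, P `<=` [set x | P x -> (i%:E < f x)%E].
  apply: (cP R (at_right m) (fun i x => P x -> (i%:E < f x)%E)) => x Px.
  have [a /andP[ma ax]] : exists a : R, (m%:E < a%:E < f x)%E.
    move: (fm _ Px); case: (f x) => [r| |]//.
      by rewrite lte_fin => mr; exists ((m + r) / 2); rewrite !lte_fin midf_lt// midf_lt.
    by move=> _; exists (m + 1); rewrite lte_fin ltrDl ltry andbT.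
  exists ([set y | P y -> (a%:E < f y)%E], [set i | i < a]) => /=.
    split; first exact: lf.
    by apply: nbhs_right_lt; rewrite -lte_fin.
  by move=> [y i] /= [fay ia] /fay; apply: le_lt_trans; rewrite lee_fin ltW.
move=> H.
have [i [mi Hi]] : exists i, m < i /\ P `<=` [set x | P x -> (i%:E < f x)%E].
  near (m^'+) => i; exists i; split; last by near: i.
  by near: i; exact: nbhs_right_gt.
have : (i%:E <= ereal_inf (f @` P))%E.
  by apply: le_ereal_inf_tmp => _ [x Px <-]; apply/ltW/(Hi _ Px).
by rewrite mE lee_fin leNgt mi.
Unshelve. all: by end_near. Qed.

Lemma lsc_addr_continuous P g (h : 'rV[R]_n -> R) : lsc_on P g -> continuous h ->
  lsc_on P (fun x => g x + (h x)%:E)%E.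
Proof.
move=> lg ch x Px a agh.
have [b [bg ab]] : exists b : R, (b%:E < g x)%E /\ a - b < h x.
  move: agh; case: (g x) => [r| |]//.
    rewrite lte_fin => ar; exists (r - (r + h x - a) / 2); rewrite lte_fin.
    by split; lra.
  by move=> _; exists (a - h x + 1); split; [exact: ltry|lra].
have H1 := lg x Px b bg.
have H2 : \forall y \near x, a - b < h y
  by exact: (cvgr_gt (h x) (ch x) _ ab).
apply: filterS2 H1 H2 => y /[swap] hy /[apply].
case: (g y) => [r| |]; [|by move=> _; rewrite addye// ltry|by []].
by rewrite !lte_fin => br; lra.
Qed.

Lemma dotv_ge0 (x : 'rV[R]_n) : 0 <= dotv x x.
Proof. by apply: sumr_ge0 => i _; rewrite -expr2 sqr_ge0. Qed.

Lemma dotvDr (x y z : 'rV[R]_n) : dotv x (y + z) = dotv x y + dotv x z.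
Proof. by rewrite !(dotvC x) dotvDl. Qed.

Lemma dotvZr a (x y : 'rV[R]_n) : dotv x (a *: y) = a * dotv x y.
Proof. by rewrite !(dotvC x) dotvZl. Qed.

Lemma dotv_sqrD (x y : 'rV[R]_n) t : dotv (x + t *: y) (x + t *: y) =
  dotv x x + 2 * t * dotv x y + t * t * dotv y y.
Proof. by rewrite dotvDl !dotvDr !dotvZl !dotvZr (dotvC y x); ring. Qed.

Lemma dotv_subsub_continuous (z : 'rV[R]_n) :
  continuous (fun y : 'rV[R]_n => dotv (y - z) (y - z)).
Proof.
apply: (@continuous_sum R 'rV[R]_n R^o n (fun i (y : 'rV[R]_n) => (y - z) 0 i * (y - z) 0 i)) => i.
have c : continuous (fun y : 'rV[R]_n => (y - z) 0 i : R^o).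
  move=> y; rewrite (_ : (fun y => _) = fun y : 'rV[R]_n => y 0 i + (- z) 0 i); last first.
    by apply/funext => t; rewrite mxE.
  apply: (@continuousD R R^o 'rV[R]_n (fun y => y 0 i) (fun=> (- z) 0 i) y).
    exact: (@coord_continuous R 1 n 0 i y).
  exact: cst_continuous.
move=> y; exact: (@continuousM R 'rV[R]_n _ _ y (c y) (c y)).
Qed.

(* Minimising the Moreau-type penalisation [g + K |. - x|^2] yields a point at
   which [g] has an affine minorant; as [g] is bounded below, the value of this
   minorant at [x] exceeds [c] once [K] is large. *)
Lemma affine_minorant P g x c : compact P ->
  (forall y z t, P y -> P z -> 0 <= t <= 1 -> P ((1 - t) *: y + t *: z)) ->
  lsc_on P g -> convex_on P g -> (forall y, P y -> 0 <= g y)%E ->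
  P x -> (c%:E < g x)%E ->
  exists al v, (forall y, P y -> ((al + dotv y v)%:E <= g y)%E) /\
    c <= al + dotv x v.
Proof.
move=> cP vP lg vg g0 Px cg.
have [[x0 Px0 gx0]|/forall2NP ny] := pselect (exists2 y, P y & (g y < +oo)%E); last first.
  exists c, 0; split=> [y Py|]; last by rewrite dotvC dotv0l addr0.
  by case: (ny y) => // /negP; rewrite -leNgt leye_eq => /eqP ->; rewrite leey.
have /nbhs_ballP[d /= d0 dg] := lg x Px c cg.
(* This gives [K d^2 >= |c|]: outside the ball where [g > c], the penalty alone reaches [c]. *)
pose K := `|c| / d ^+ 2 + 1.
have K0 : 0 < K by rewrite ltr_wpDl// divr_ge0// sqr_ge0.
pose h y := K * dotv (y - x) (y - x).
have ch : continuous h.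
  move=> y; apply: (@continuousM R 'rV[R]_n (fun=> K) (fun y => dotv (y - x) (y - x)) y).
    exact: cst_continuous.
  exact: dotv_subsub_continuous.
pose f y := (g y + (h y)%:E)%E.
have h0 y : 0 <= h y by rewrite mulr_ge0 ?dotv_ge0// ltW.
have f0 y : P y -> (0 <= f y)%E by move=> Py; rewrite adde_ge0 ?g0// lee_fin.
have [|y0 Py0 [fy0 y0min]] := lsc_compact_min cP (lsc_addr_continuous lg ch) f0.
  by exists x0 => //; rewrite /f lte_add_pinfty// ltry.
have cf y : P y -> (c%:E <= f y)%E.
  move=> Py; have [xy|xy] := pselect (ball x d y).
    by rewrite (le_trans (ltW (dg _ xy Py)))// leeDl// lee_fin.
  apply: (@le_trans _ _ (h y)%:E); last by rewrite leeDr// g0.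
  have [i iy] : exists i, d <= `|(y - x) 0 i|.
    apply/not_existsP => ni; apply: xy; split=> // j i; rewrite ord1.
    rewrite /ball/= distrC ltNge; apply/negP => dyx; apply: (ni i).
    by rewrite !mxE.
  have d2 : d ^+ 2 <= dotv (y - x) (y - x).
    rewrite /dotv (bigD1 i)//= -expr2 -[X in _ <= X + _]real_normK ?num_real//.
    apply: (@le_trans _ _ (`|(y - x) 0 i| ^+ 2)).
      by rewrite !expr2; apply: ler_pM => //; exact: ltW.
    by rewrite lerDl; apply: sumr_ge0 => j _; rewrite -expr2 sqr_ge0.
  rewrite lee_fin (le_trans (ler_norm c))//.
  rewrite (@le_trans _ _ (K * d ^+ 2))//; last by rewrite ler_wpM2l// ltW.
  rewrite /K mulrDl mul1r divfK; last by rewrite sqrf_eq0 gt_eqF.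
  by rewrite lerDl sqr_ge0.
have gy0 : g y0 \is a fin_num by move: fy0; rewrite /f fin_numD => /andP[].
pose r0 := fine (g y0).
have gr0 : g y0 = r0%:E by rewrite fineK.
(* The slope is minus the gradient of the penalty at the minimiser [y0]. At [x] the affine function
   equals [g(y0) + 2 K |x - y0|^2], which is at least the penalised minimum and hence at least
   [c]. *)
exists (r0 - dotv y0 ((2 * K) *: (x - y0))), ((2 * K) *: (x - y0)).
have aE y : r0 - dotv y0 ((2 * K) *: (x - y0)) + dotv y ((2 * K) *: (x - y0)) =
    r0 + 2 * K * dotv (y - y0) (x - y0).
  by rewrite !dotvZr dotvBl; ring.
split=> [y Py|]; rewrite aE; last first.
  have := cf _ Py0; rewrite /f gr0 lee_fin => /le_trans; apply.
  have -> : dotv (x - y0) (x - y0) = dotv (y0 - x) (y0 - x).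
    by rewrite -(opprB x y0) -(scaleN1r (x - y0)) dotvZl dotvZr mulrA mulrNN !mul1r.
  by have := h0 y0; rewrite /h; lra.
have gN : g y != -oo%E.
  by apply/eqP => gy; have := g0 _ Py; rewrite gy.
case gy : (g y) gN => [r| |]// _; last by rewrite leey.
rewrite lee_fin.
pose A := y0 - x; pose B := y - y0.
(* Minimality at [y0] is tested on the segment towards [y]; convexity of [g] leaves a factor [t],
   which is divided out. *)
have key t : 0 < t < 1 -> 0 <= (r - r0) + 2 * K * dotv A B + t * (K * dotv B B).
  move=> /andP[t0 t1].
  have Pt : P ((1 - t) *: y0 + t *: y) by apply: vP => //; rewrite !ltW.
  have := vg y0 y t Py0 Py; rewrite t0 t1 => /(_ isT).
  have := y0min _ Pt; rewrite /f gr0 gy.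
  move: (g0 _ Pt); case: (g _) => [s| |]//= _; rewrite !lee_fin => Hmin Hs.
  have tE : (1 - t) *: y0 + t *: y - x = A + t *: B.
    by rewrite /A /B scalerBl scale1r scalerBr; apply/rowP => i; rewrite !mxE; ring.
  move: Hmin; rewrite /h tE dotv_sqrD -/A => Hmin.
  have : 0 <= t * ((r - r0) + 2 * K * dotv A B + t * (K * dotv B B)) by nra.
  by rewrite pmulr_rge0.
have -> : dotv B (x - y0) = - dotv A B.
  by rewrite dotvC /A -mulN1r -dotvZl scaleN1r opprB.
suff : 0 <= (r - r0) + 2 * K * dotv A B by lra.
rewrite leNgt; apply/negP => neg.
set D := _ + _ in neg key.
pose C := K * dotv B B.
have C0 : 0 <= C by rewrite mulr_ge0 ?dotv_ge0// ltW.
(* An explicit substitute for [t -> 0]: here [t C <= - D / 2], so [D + t C <= D / 2 < 0] contradicts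
   [key]. *)
pose t := - D / (2 * (C - D + 1)).
have E0 : 0 < 2 * (C - D + 1) by lra.
have tC : t * (2 * (C - D + 1)) = - D by rewrite /t divfK// gt_eqF.
have t0 : 0 < t by rewrite divr_gt0//; lra.
have t1 : t < 1 by rewrite ltr_pdivrMr// mul1r; lra.
have := key t; rewrite t0 t1 => /(_ isT); rewrite -/C.
by nra.
Qed.

Lemma rat_affine_minorant P g x c : compact P ->
  (forall y z t, P y -> P z -> 0 <= t <= 1 -> P ((1 - t) *: y + t *: z)) ->
  lsc_on P g -> convex_on P g -> (forall y, P y -> 0 <= g y)%E ->
  P x -> (c%:E < g x)%E ->
  exists (a : 'rV[rat]_n) (b : rat),
    (forall y, P y -> ((dotv y (map_mx ratr a) + ratr b)%:E <= g y)%E) /\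
    c < dotv x (map_mx ratr a) + ratr b.
Proof.
move=> cP vP lg vg g0 Px cg.
have [c' [cc' cg']] : exists c' : R, c < c' /\ (c'%:E < g x)%E.
  move: cg; case: (g x) => [r| |]//.
    by rewrite lte_fin => cr; exists ((c + r) / 2); rewrite !lte_fin !midf_lt.
  by move=> _; exists (c + 1); rewrite ltrDl ltry.
have [al [v [vle vx]]] := affine_minorant cP vP lg vg g0 Px cg'.
have [M M0 PM] := compact_bound cP.
(* Rounding the slope costs at most [eta] on [P]; lowering the constant by between [eta] and [2 eta]
   restores the minorant. The value at [x] thus drops by less than [3 eta], short of the gap. *)
pose eta := (c' - c) / 4.
have eta0 : 0 < eta by rewrite divr_gt0// subr_gt0.
pose e := eta / (n%:R * M + 1).
have nM0 : 0 < n%:R * M + 1 by rewrite ltr_wpDl// mulr_ge0// ltW.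
have e0 : 0 < e by rewrite divr_gt0.
have /choice[a aP] i : exists q : rat, `|v 0 i - ratr q| <= e.
  have : v 0 i - e < v 0 i + e by lra.
  move=> /rat_in_itvoo[q]; rewrite in_itv /= => /andP[q1 q2]; exists q.
  by rewrite ler_distl; apply/andP; split; lra.
have [b /andP[b1 b2]] : exists b : rat, al - 2 * eta < ratr b < al - eta.
  have : al - 2 * eta < al - eta by lra.
  by move=> /rat_in_itvoo[b]; rewrite in_itv /=; exists b.
pose aa : 'rV[rat]_n := \row_i a i.
have close y : P y -> `|dotv y v - dotv y (map_mx ratr aa)| <= eta.
  move=> /PM yM; rewrite !(dotvC y) -dotvBl /dotv.
  apply: (le_trans (ler_norm_sum _ _ _)).
  apply: (@le_trans _ _ (\sum_(i < n) e * M)).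
    apply: ler_sum => i _; rewrite normrM ler_pM//; first by rewrite !mxE.
    exact: le_trans (ler_coord_norm y i) yM.
  rewrite sumr_const card_ord -mulr_natl /e.
  rewrite -(mulrA eta) mulrCA ger_pMr// mulrCA mulrC ler_pdivrMr// mul1r.
  by rewrite lerDl.
exists aa, b; split=> [y Py|].
  apply: le_trans (vle y Py); rewrite lee_fin.
  have := close y Py; rewrite ler_distl => /andP[]; lra.
have := close x Px; rewrite ler_distl => /andP[] ? ?.
have : 4 * eta = c' - c by rewrite /eta; field.
lra.
Qed.

(** Rational affine functions can be enumerated; those that are not minorants are replaced by zero,
    which is one since [g >= 0]. Slot 0 is reserved for zero, so that maxima over initial segments
    are nonnegative. *)
Lemma rat_affine_minorants P g : compact P ->
  (forall y z t, P y -> P z -> 0 <= t <= 1 -> P ((1 - t) *: y + t *: z)) ->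
  lsc_on P g -> convex_on P g -> (forall y, P y -> 0 <= g y)%E ->
  exists (a : nat -> 'rV[rat]_n) (b : nat -> rat),
    [/\ a 0%N = 0, b 0%N = 0,
        forall i y, P y -> ((dotv y (map_mx ratr (a i)) + ratr (b i))%:E <= g y)%E &
        forall x c, P x -> (c%:E < g x)%E ->
          exists i, c < dotv x (map_mx ratr (a i)) + ratr (b i)].
Proof.
move=> cP vP lg vg g0.
pose mi (p : 'rV[rat]_n * rat) := forall y, P y ->
  ((dotv y (map_mx ratr p.1) + ratr p.2)%:E <= g y)%E.
have m0 : mi (0, 0).
  by move=> y Py; rewrite /= map_mx0 dotvC dotv0l rmorph0 addr0 g0.
pose sel (i : nat) : 'rV[rat]_n * rat := if i is j.+1 then
  if unpickle j is Some p then if `[< mi p >] then p else (0, 0) else (0, 0)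
  else (0, 0).
have msel i : mi (sel i).
  by case: i => //= j; case: unpickle => // p; case: asboolP.
exists (fun i => (sel i).1), (fun i => (sel i).2); split=> //.
move=> x c Px cg; have [a [b [abm abx]]] := rat_affine_minorant cP vP lg vg g0 Px cg.
exists (pickle (a, b)).+1; rewrite /sel pickleK.
by case: asboolP.
Qed.

End minorants.

(** * The Futaki invariant and the mu-entropy *)

Section expR_facts.
Context {R : realType}.
Implicit Types u a b t : R.

(** From [1 - u <= exp(- u)] comes [(1 - u) exp u <= 1], while [(1 - u) (1 + u + 2 u^2) = 1 + u^2 (1
    - 2 u) >= 1]. *)
Lemma expR_le_quadratic u : u <= 1 / 2 -> expR u <= 1 + u + 2 * u ^+ 2.
Proof.
move=> u2; have h : expR u * (1 - u) <= 1.
  rewrite -[leRHS](expRxMexpNx_1 u) ler_wpM2l ?expR_ge0//.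
  exact: expR_ge1Dx.
have : 0 <= u ^+ 2 * (1 - 2 * u) by rewrite mulr_ge0 ?sqr_ge0//; lra.
by nra.
Qed.

(** The left side is [1 - (1 - u) exp u], and [exp u >= 1 + u]. Integrated, this is the quadratic
    bound on the entropy. *)
Lemma mul_expR_sub_le_sqr u : u <= 1 -> u * expR u - expR u + 1 <= u ^+ 2.
Proof. by move=> u1; have := expR_ge1Dx u; nra. Qed.

(** Tangent line at the weighted mean [m]: the linear terms cancel in the combination. *)
Lemma expR_convex t a b : 0 <= t <= 1 ->
  expR ((1 - t) * a + t * b) <= (1 - t) * expR a + t * expR b.
Proof.
move=> /andP[t0 t1].
have H (m c : R) : expR m * (1 + (c - m)) <= expR c.
  rewrite -[leRHS](_ : expR m * expR (c - m) = _); last first.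
    by rewrite -expRD subrKC.
  by rewrite ler_wpM2l ?expR_ge0//; exact: expR_ge1Dx.
set m := (_ + _); have := H m a; have := H m b; set em := expR m => Hb Ha.
have -> : em = (1 - t) * (em * (1 + (a - m))) + t * (em * (1 + (b - m))).
  by rewrite /m; ring.
by rewrite lerD// ler_wpM2l// subr_ge0.
Qed.

Lemma lne_sub_lower a b : 0 < a -> 0 < b -> a - b <= a * (ln a - ln b).
Proof.
move=> a0 b0; have := expR_ge1Dx (ln b - ln a).
rewrite expRD expRN !lnK// => H.
have : a * (1 + (ln b - ln a)) <= a * (b / a) by rewrite ler_wpM2l// ltW.
by rewrite mulrCA divff ?gt_eqF// mulr1; lra.
Qed.

End expR_facts.

(** A strict superlevel set in [P] is the trace of an open set, the interior of
    [{y | P y -> a < f y}]. *)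
Lemma lsc_measurable {R : realType} n (P : set 'rV[R]_n) (f : 'rV[R]_n -> \bar R) :
  lsc_on P f -> measurable_fun P f.
Proof.
move=> lf mP; move: (mP); apply: (measurability _ (ErealGenOInfty.measurableE R)).
move=> _ [_ [a ->] <-].
pose U := interior [set y | P y -> (a%:E < f y)%E].
rewrite (_ : _ `&` _ = P `&` U).
  by apply: measurableI => //; apply: open_measurable_rV; exact: open_interior.
apply/seteqP; split=> x [Px]; rewrite /= in_itv/= andbT.
  by move=> af; split=> //; exact: lf.
by move=> Ux; split=> //; exact: (interior_subset Ux).
Qed.

(** * Bounded measurable functions and real-valued integrals *)

Section bm.
Context {R : realType} {n : nat}.
Implicit Types (P : set 'rV[R]_n) (f g : 'rV[R]_n -> R).

Definition bm P f := measurable_fun P f /\ bdd_on P f.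

Lemma bm_cst P c : bm P (fun=> c).
Proof. by split; [exact: measurable_cst|exists `|c|]. Qed.

Lemma bmD P f g : bm P f -> bm P g -> bm P (fun x => f x + g x).
Proof.
move=> [mf [M fM]] [mg [N gN]]; split; first exact: measurable_funD.
by exists (M + N) => x Px; rewrite (le_trans (ler_normD _ _))// lerD ?fM ?gN.
Qed.

Lemma bmM P f g : bm P f -> bm P g -> bm P (fun x => f x * g x).
Proof.
move=> [mf [M fM]] [mg [N gN]]; split; first exact: measurable_funM.
by exists (M * N) => x Px; rewrite normrM ler_pM ?fM ?gN.
Qed.

Lemma bmZ P c f : bm P f -> bm P (fun x => c * f x).
Proof. by move=> bf; apply: bmM => //; exact: bm_cst. Qed.

Lemma bm_expR P f : bm P f -> bm P (fun x => expR (f x)).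
Proof.
move=> [mf [M fM]]; split; first exact: measurableT_comp.
exists (expR M) => x Px; rewrite ger0_norm ?expR_ge0// ler_expR.
by rewrite (le_trans (ler_norm _))// fM.
Qed.

Lemma bm_dotv P u : compact P -> bm P (fun x => dotv x u).
Proof.
move=> cP; split; first exact: (continuous_measurable_rV (@dotv_continuous R n u)).
have [M M0 PM] := compact_bound cP.
exists (n%:R * (M * `|u|)) => x /PM xM.
apply: (le_trans (dotv_norm x u)); apply: ler_wpM2l; first exact: ler0n.
by apply: ler_wpM2r.
Qed.

End bm.

Section rint.
Context {R : realType} {n : nat} (P : set 'rV[R]_n).
Context (B : ('rV[R]_n -> \bar R) -> \bar R) (pB : posint P B).
Implicit Types f g : 'rV[R]_n -> R.

Definition rint f : R := fine (B (fun x => (f x)%:E)).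

Lemma rintE f : bm P f -> B (fun x => (f x)%:E) = (rint f)%:E.
Proof. by move=> [mf bf]; rewrite /rint fineK// (posint_fin pB). Qed.

Lemma eq_rint f g : (forall x, P x -> f x = g x) -> rint f = rint g.
Proof. by move=> fg; rewrite /rint; congr fine; apply: (posint_ext pB) => x /fg ->. Qed.

Lemma rint_lin a f g : bm P f -> bm P g ->
  rint (fun x => a * f x + g x) = a * rint f + rint g.
Proof.
move=> bf bg; apply: EFin_inj.
rewrite -rintE; last by apply: bmD => //; exact: bmZ.
rewrite (posint_lin pB) ?bf.1 ?bf.2 ?bg.1 ?bg.2//; last 4 first.
- exact: bf.1.
- exact: bf.2.
- exact: bg.1.
- exact: bg.2.
by rewrite !rintE// EFinD EFinM.
Qed.

Lemma rint0 : rint (fun=> 0) = 0.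
Proof.
have := rint_lin 1 (bm_cst P 0) (bm_cst P 0).
by rewrite mulr0 addr0 mul1r => /eqP; rewrite -subr_eq subrr eq_sym => /eqP.
Qed.

Lemma rintZ a f : bm P f -> rint (fun x => a * f x) = a * rint f.
Proof.
move=> bf; rewrite -[RHS]addr0 -rint0 -rint_lin//; last exact: bm_cst.
by apply: eq_rint => x _; rewrite addr0.
Qed.

Lemma rintD f g : bm P f -> bm P g ->
  rint (fun x => f x + g x) = rint f + rint g.
Proof.
move=> bf bg; rewrite -[rint f]mul1r -rint_lin//.
by apply: eq_rint => x _; rewrite mul1r.
Qed.

Lemma rint_ge0 f : bm P f -> (forall x, P x -> 0 <= f x) -> 0 <= rint f.
Proof.
move=> bf f0; rewrite -lee_fin -rintE//; apply: (posint_ge0 pB) => //.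
by apply/measurable_EFinP; exact: bf.1.
Qed.

Lemma rint_le f g : bm P f -> bm P g -> (forall x, P x -> f x <= g x) ->
  rint f <= rint g.
Proof.
move=> bf bg fg; rewrite -subr_ge0 addrC -mulN1r -rint_lin//.
apply: rint_ge0; first by apply: bmD => //; exact: bmZ.
by move=> x Px; rewrite mulN1r addrC subr_ge0 fg.
Qed.

End rint.

Section rpl.
Context {R : realType} {n m : nat}.
Context (a : 'I_m.+1 -> 'rV[rat]_n) (b : 'I_m.+1 -> rat).

Local Notation A i x := (dotv x (map_mx ratr (a i)) + ratr (b i)).

Definition rplr (x : 'rV[R]_n) : R := fine (rpl a b x).

Lemma rplE x : rpl a b x = (rplr x)%:E.
Proof.
rewrite /rplr fineK// fin_numElt; apply/andP; split.
  by apply: lt_le_trans (le_bigmax _ _ ord0); rewrite ltNyr.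
by apply/bigmax_ltP; split=> // i _; rewrite ltry.
Qed.

Lemma rplr_ge x i : A i x <= rplr x.
Proof. by rewrite -lee_fin -rplE; exact: (le_bigmax -oo%E). Qed.

Lemma rplr_le x c : (forall i, A i x <= c) -> rplr x <= c.
Proof.
move=> h; rewrite -lee_fin -rplE; apply/bigmax_leP; split; first exact: leNye.
by move=> i _; rewrite lee_fin.
Qed.

Lemma rplr_gt x c : c < rplr x -> exists i, c < A i x.
Proof.
rewrite -lte_fin -rplE => /bigmax_gtP[|[i _]]; first by rewrite ltNge leNye.
by rewrite lte_fin; exists i.
Qed.

Lemma rplr_convex x y t : 0 <= t <= 1 ->
  rplr ((1 - t) *: x + t *: y) <= (1 - t) * rplr x + t * rplr y.
Proof.
move=> /andP[t0 t1]; apply: rplr_le => i; rewrite dotvDl !dotvZl.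
have := rplr_ge x i; have := rplr_ge y i.
set u := dotv x _; set v := dotv y _; set c := ratr _ => hy hx.
have -> : (1 - t) * u + t * v + c = (1 - t) * (u + c) + t * (v + c) by ring.
by rewrite lerD// ler_wpM2l// subr_ge0.
Qed.

Lemma rplr_lsc P c : 0 < c -> lsc_on P (fun x => (c * rplr x)%:E).
Proof.
move=> c0 x _ r; rewrite lte_fin -ltr_pdivrMl// => /rplr_gt[i ri].
have ca : continuous (fun y : 'rV[R]_n => A i y : R^o).
  move=> y; apply: (@continuousD R R^o 'rV[R]_n (fun y => dotv y (map_mx ratr (a i)))
    (fun=> ratr (b i)) y); [exact: dotv_continuous|exact: cst_continuous].
have : \forall y \near x, c^-1 * r < A i y by exact: (cvgr_gt (A i x) (ca x) _ ri).
apply: filterS => y ry _; rewrite lte_fin -ltr_pdivrMl//.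
exact: lt_le_trans ry (rplr_ge y i).
Qed.

Lemma bm_rplr P : compact P -> bm P rplr.
Proof.
move=> cP; split.
  apply/measurable_EFinP.
  rewrite (_ : _ \o _ = fun x => (1 * rplr x)%:E); last first.
    by apply/funext => x /=; rewrite mul1r.
  by apply: lsc_measurable; exact: rplr_lsc.
have /choice[M PM] i : exists M, forall x, P x -> `|A i x| <= M.
  exact: (bmD (bm_dotv _ cP) (bm_cst P (ratr (b i)))).2.
exists (\sum_i `|M i|) => x Px.
have AM i : `|A i x| <= \sum_i `|M i|.
  rewrite (le_trans (PM i x Px))// (le_trans (ler_norm _))//.
  by rewrite (bigD1 i)//= lerDl sumr_ge0.
rewrite ler_norml; apply/andP; split.
  apply: le_trans (rplr_ge x ord0).
  by have := AM ord0; rewrite ler_norml => /andP[].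
by apply: rplr_le => i; rewrite (le_trans (ler_norm _)).
Qed.

End rpl.

Section expeR_composition.
Context {R : realType} {n : nat}.
Implicit Types (P : set 'rV[R]_n) (q : 'rV[R]_n -> \bar R).

Lemma lsc_expeR P q : (forall x, P x -> q x != -oo%E) -> lsc_on P q ->
  lsc_on P (fun x => expeR (q x)).
Proof.
move=> qNy lq x Px a aq.
have [d [dq ad]] : exists d : R, (d%:E < q x)%E /\ a <= expR d.
  have [a0|a0] := leP a 0.
    have [d dq] : exists d : R, (d%:E < q x)%E.
      move: (qNy x Px); case: (q x) => [r| |]// _; last by exists 0; rewrite ltry.
      by exists (r - 1); rewrite lte_fin ltrBlDr ltrDl.
    by exists d; split=> //; rewrite (le_trans a0)// expR_ge0.
  exists (ln a); rewrite lnK//; split=> //.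
  by rewrite -lte_expeR/= lnK.
apply: filterS (lq x Px d dq) => y dy Py.
apply: (@le_lt_trans _ _ (expeR d%:E)); first by rewrite lee_fin.
by rewrite lte_expeR dy.
Qed.

Lemma convex_expeR_sub P q u : (forall x, P x -> q x != -oo%E) ->
  convex_on P q -> convex_on P (fun x => expeR (q x + (- dotv x u)%:E)).
Proof.
move=> qNy cq x y t Px Py /[dup] t01 /andP[t0 t1].
have t1' : 0 < 1 - t by rewrite subr_gt0.
have := cq x y t Px Py t01; have := qNy x Px; have := qNy y Py.
case: (q y) => [b| |]// _.
  case: (q x) => [a| |]// _.
    set z := q _; rewrite -!EFinM -EFinD => zle.

    apply: (le_trans (y := expeR (((1 - t) * (a - dotv x u) + t * (b - dotv y u))%:E))).
      rewrite lee_expeR dotvDl !dotvZl.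
      rewrite (_ : ((1 - t) * (a - dotv x u) + t * (b - dotv y u))%:E =
        ((1 - t) * a + t * b)%:E + (- ((1 - t) * dotv x u + t * dotv y u))%:E)%E.
        exact: leeD2r.
      by rewrite -EFinD; congr EFin; ring.
    by rewrite lee_fin expR_convex// !ltW.
  by rewrite /= gt0_muley ?lte_fin// addye ?leey.
move=> _ _; rewrite /= (gt0_muley (x := t%:E)) ?lte_fin// addey ?leey//.
rewrite -ltNye; apply: (@lt_le_trans _ _ 0%E) => //.
by rewrite mule_ge0 ?expeR_ge0// lee_fin ltW.
Qed.

End expeR_composition.

(** Positive parts increase and negative parts decrease. This form serves the entropy bound, whose
    larger side may have integral [+oo]. *)
Lemma measurable_le_integral d (T : measurableType d) (R : realType)
    (mu : {measure set T -> \bar R}) (D : set T) (f g : T -> \bar R) :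
  measurable D -> measurable_fun D f -> measurable_fun D g ->
  (forall x, D x -> f x <= g x)%E ->
  (\int[mu]_(x in D) f x <= \int[mu]_(x in D) g x)%E.
Proof.
move=> mD mf mg fg; rewrite (integralE mu D f) (integralE mu D g); apply: leeB.
  apply: ge0_le_integral => //.
  - exact: measurable_funepos.
  - exact: measurable_funepos.
  - by move=> x Dx; apply: (@funepos_le _ _ D); rewrite ?inE// => y /set_mem; exact: fg.
apply: ge0_le_integral => //.
- exact: measurable_funeneg.
- exact: measurable_funeneg.
- by move=> x Dx; apply: (@funeneg_le _ _ D); rewrite ?inE// => y /set_mem; exact: fg.
Qed.

(** * The Futaki functional and the two implications *)

Section semistability.
Context {R : realType} {n : nat} (S : seq 'rV[R]_n).
Hypothesis HS : forall s, s \in S -> is_lattice s.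
Hypothesis Hint : interior (conv_hull S) !=set0.
Variables (lam : R) (xi : 'rV[R]_n).
Hypothesis hlam : lam <= 0.

Local Notation P := (conv_hull S).
Local Notation I := (rint (int_P P)).
Local Notation B := (rint (bd_int P)).
Local Notation l := (fun x : 'rV[R]_n => dotv x xi).
Local Notation e := (fun x : 'rV[R]_n => expR (dotv x xi)).

Let cP : compact P := @compact_conv_hull _ _ S.
Let mP : measurable P := @measurable_conv_hull _ _ S.
Let pI : posint P (int_P P) := posint_int_P mP (lebm_compact cP).
Let pB : posint P (bd_int P) := posint_bd_int HS.
Let bl : bm P l := bm_dotv xi cP.
Let be : bm P e := bm_expR bl.

Let int_PE f : measurable_fun P f ->
  int_P P f = (\int[lebm R n]_(x in P) f x)%E.
Proof. exact: leb_int_mask. Qed.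

Let I1_gt0 : 0 < I (fun=> 1).
Proof.
rewrite -lte_fin -(rintE pI); last exact: bm_cst.
rewrite int_PE; last exact: measurable_cst.
rewrite integral_cst// mul1e.
have [x /nbhs_ballP[d /= d0 dP]] := Hint.
have /andP[m0 _] := lebm_ball x d0.
apply: lt_le_trans m0 _; apply: le_measure; rewrite ?inE//.
exact: ball_measurable_rV.
Qed.

Let rint_gt0 f c : bm P f -> 0 < c -> (forall x, P x -> c <= f x) -> 0 < I f.
Proof.
move=> bf c0 cf; apply: (@lt_le_trans _ _ (c * I (fun=> 1))).
  by rewrite mulr_gt0.
rewrite -(rintZ pI)//; last exact: bm_cst.
by apply: (rint_le pI) => //; [exact/bmZ/bm_cst|move=> x Px; rewrite mulr1 cf].
Qed.

Let rint_expR_gt0 f : bm P f -> 0 < I (fun x => expR (f x)).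
Proof.
move=> bf; have [M fM] := bf.2.
apply: (rint_gt0 (c := expR (- M))); [exact: bm_expR|exact: expR_gt0|].
by move=> x Px; rewrite ler_expR; have := fM x Px; rewrite ler_norml => /andP[].
Qed.

Local Notation Z := (I e).
Let Z0 : 0 < Z := rint_expR_gt0 bl.
(** [s] is the constant [\bar{s}] of the Futaki invariant, and [Phi (h e) = Z Fut(h)] for bounded
    measurable [h]. Taking the product [h e] as argument lets [exp q] be inserted directly. *)
Let s : R := (2 * pi * B e - lam * I (fun x => l x * e x)) / Z.
Let Phi (f : 'rV[R]_n -> R) : R :=
  2 * pi * B f - lam * I (fun x => l x * f x) - s * I f.

Let Phi_lin a f g : bm P f -> bm P g ->
  Phi (fun x => a * f x + g x) = a * Phi f + Phi g.
Proof.
move=> bf bg; rewrite /Phi (rint_lin pB)// (rint_lin pI)//.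
rewrite (_ : I (fun x => l x * (a * f x + g x)) =
    a * I (fun x => l x * f x) + I (fun x => l x * g x)); first by ring.
rewrite -(rint_lin pI); [|exact: bmM|exact: bmM].
by apply: (eq_rint pI) => x _; ring.
Qed.

(** The Futaki invariant vanishes on the constant 1, by the choice of [s]. *)
Let Phie : Phi e = 0.
Proof. by rewrite /Phi /s divfK ?gt_eqF// subrr. Qed.

Let eq_Phi f g : (forall x, P x -> f x = g x) -> Phi f = Phi g.
Proof.
move=> fg; rewrite /Phi (eq_rint pB fg) (eq_rint pI fg).
by rewrite (@eq_rint _ _ _ _ pI (fun x => l x * f x) (fun x => l x * g x))// => x /fg ->.
Qed.

Let FutE h : bm P h ->
  Fut P lam xi (fun x => (h x)%:E) = (Phi (fun x => h x * e x) / Z)%:E.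
Proof.
move=> bh; rewrite /Fut /=.
rewrite -/(rint (int_P P) e).
rewrite (_ : bd_int P (fun x => (expR (dotv x xi))%:E) = (B e)%:E); last first.
  exact: (rintE pB be).
rewrite (_ : int_P P (fun x => (dotv x xi * expR (dotv x xi))%:E) =
  (I (fun x => l x * e x))%:E); last exact: (rintE pI (bmM bl be)).
rewrite (_ : bd_int P (fun x => (h x)%:E * (expR (dotv x xi))%:E)%E =
  (B (fun x => h x * e x))%:E); last exact: (rintE pB (bmM bh be)).
rewrite (_ : int_P P (fun x => (h x)%:E * (expR (dotv x xi))%:E)%E =
  (I (fun x => h x * e x))%:E); last exact: (rintE pI (bmM bh be)).
rewrite (_ : int_P P (fun x => (h x)%:E * (dotv x xi * expR (dotv x xi))%:E)%E =
  (I (fun x => l x * (h x * e x)))%:E); last first.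
  rewrite -(rintE pI); last by apply: bmM => //; exact: bmM.
  by apply: (posint_ext pI) => x _; rewrite -EFinM; congr EFin; ring.
rewrite -!(EFinM, EFinB, EFinD) /Phi /s; congr EFin; field.
by rewrite gt_eqF.
Qed.

Let muNA_lamE q : bm P q -> let E := fun x => expR (q x) in
  muNA_lam P lam (fun x => (q x)%:E) =
  (- (2 * pi) * (B E / I E) +
    lam * (I (fun x => (n%:R + q x) * E x) / I E - ln (I E)))%:E.
Proof.
move=> bq E; have bE : bm P E by exact: bm_expR.
rewrite /muNA_lam /muNA /sigmaNA /= -/(rint (int_P P) E).
rewrite (rintE pB bE).
rewrite (_ : int_P P (fun x => ((n%:R)%:E + (q x)%:E) * (expR (q x))%:E)%E =
    (I (fun x => (n%:R + q x) * E x))%:E); last first.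
  by rewrite -(rintE pI)//; apply: bmM => //; apply: bmD => //; exact: bm_cst.
by rewrite -!(EFinM, EFinB, EFinD) ltry.
Qed.

Lemma maximizer_toric_semistable :
  (forall q : 'rV[R]_n -> \bar R, E1 P q ->
     (muNA_lam P lam q <= muNA_lam P lam (fun x => (dotv x xi)%:E))%E) ->
  toric_semistable P lam xi.
Proof.
move=> maxl m a b.
pose h := rplr (R := R) a b; have bh : bm P h by exact: bm_rplr.
rewrite (_ : rpl a b = fun x => (h x)%:E); last by apply/funext => x; exact: rplE.
rewrite FutE// lee_fin divr_ge0 ?(ltW Z0)//.
have [M hM] := bh.2.
have bhe : bm P (fun x => h x * e x) by exact: bmM.
have bhhe : bm P (fun x => h x ^+ 2 * e x) by apply: bmM => //; exact: bmM.
have [W WP] : exists W, forall x, P x -> `| - lam * l x - s| <= W.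
  exact: (bmD (bmZ (- lam) bl) (bm_cst P (- s))).2.
(* [K] collects the coefficients of [t^2]: the factors 2 multiplying [B] and [I] come from
   [expR_le_quadratic], [W] bounds the weight [- lam l - s], and the last term is the entropy. *)
pose K := 2 * pi * (2 * B (fun x => h x ^+ 2 * e x)) +
  W * (2 * I (fun x => h x ^+ 2 * e x)) - lam * I (fun x => h x ^+ 2 * e x).
(* Ensures [t h <= 1/2] on [P], the range of [expR_le_quadratic]. *)
pose t0 := 1 / (2 * (`|M| + 1)).
have M1 : 0 < `|M| + 1 by rewrite ltr_wpDl.
have t00 : 0 < t0 by rewrite divr_gt0// mulr_gt0.
suff key t : 0 < t -> t <= t0 -> 0 <= Phi (fun x => h x * e x) + t * K.
  rewrite leNgt; apply/negP => neg.
  pose p := Phi (fun x => h x * e x).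
  have pE : p < 0 by [].
  pose t := Num.min t0 (- p / (2 * (`|K| + 1))).
  have K1 : 0 < `|K| + 1 by rewrite ltr_wpDl.
  have tt0 : 0 < t.
    by rewrite lt_min t00/= divr_gt0 ?oppr_gt0// mulr_gt0.
  have tt1 : t <= t0 by rewrite ge_min lexx.
  have tt2 : t * (`|K| + 1) <= - p / 2.
    rewrite -ler_pdivlMr// -mulrA -invfM; rewrite ge_min; apply/orP; right.
    by [].
  have := key t tt0 tt1; rewrite -/p.
  have : t * K <= t * (`|K| + 1).
    by rewrite ler_wpM2l ?(ltW tt0)// (le_trans (ler_norm K))// lerDl.
  by lra.
move=> tt0 tt1.
pose u x := t * h x.
have bu : bm P u by exact: bmZ.
have u2 x : P x -> u x <= 1 / 2.
  move=> Px; have hx : h x <= `|M|.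
    by rewrite (le_trans (ler_norm _))// (le_trans (hM x Px))// ler_norm.
  rewrite /u; apply: (@le_trans _ _ (t * (`|M| + 1))).
    by rewrite ler_wpM2l ?(ltW tt0)// (le_trans hx)// lerDl.
  move: tt1; rewrite /t0 invfM mul1r => /(ler_wpM2r (ltW M1)).
  by rewrite -mulrA mulVf ?gt_eqF// mulr1 mul1r.
pose q x := l x + u x.
have bq : bm P q by exact: bmD.
have q1 : E1 P (fun x => (q x)%:E).
  split=> //; split; last split.
  - rewrite (_ : (fun x => _) = fun x => ((u x)%:E + (l x)%:E)%E); last first.
      by apply/funext => x; rewrite -EFinD addrC.
    by apply: lsc_addr_continuous; [exact: rplr_lsc|exact: dotv_continuous].
  - move=> x y r Px Py /andP[r0 r1].
    rewrite -!EFinM -EFinD lee_fin /q /u dotvDl !dotvZl.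
    have : h ((1 - r) *: x + r *: y) <= (1 - r) * h x + r * h y.
      by apply: rplr_convex; rewrite !ltW.
    by move=> /(ler_wpM2l (ltW tt0)); lra.
  - rewrite -[X in int_P P X]/(fun x => (expR (q x))%:E) (rintE pI) ?ltry//.
    exact: bm_expR.
have := maxl _ q1; rewrite (muNA_lamE bq) (muNA_lamE bl) lee_fin.
set E := fun x => expR (q x).
have bE : bm P E by exact: bm_expR.
have Zq0 : 0 < I E by exact: rint_expR_gt0.
have Iq : I (fun x => (n%:R + q x) * E x) =
    n%:R * I E + (I (fun x => l x * E x) + I (fun x => u x * E x)).
  rewrite -(rintD pI); [|exact: bmM|exact: bmM].
  rewrite -(rint_lin pI)//; last by apply: bmD; exact: bmM.
  by apply: (eq_rint pI) => x _; rewrite /q; ring.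
have Il : I (fun x => (n%:R + l x) * e x) = n%:R * Z + I (fun x => l x * e x).
  rewrite -(rint_lin pI)//; last exact: bmM.
  by apply: (eq_rint pI) => x _; ring.
rewrite Iq Il => Hmax.
have Ee x : E x = e x * expR (u x) by rewrite /E /q expRD.
(* Maximality multiplied by the mass [I E]: the terms in [n] cancel, and the integrals of [e]
   combine into [s]. *)
have PhiE : lam * (I (fun x => u x * E x) - I E * (ln (I E) - ln Z)) <= Phi E.
  move: Hmax; rewrite -(ler_pM2r Zq0) => Hmax.
  have sZ : s * Z = 2 * pi * B e - lam * I (fun x => l x * e x).
    by rewrite /s divfK// gt_eqF.
  have L1 : (- (2 * pi) * (B E / I E) +
     lam * ((n%:R * I E + (I (fun x => l x * E x) + I (fun x => u x * E x))) / I E -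
      ln (I E))) * I E = - (2 * pi) * B E +
      lam * (n%:R * I E + (I (fun x => l x * E x) + I (fun x => u x * E x)) -
      ln (I E) * I E).
    by field; rewrite gt_eqF.
  have L2 : (- (2 * pi) * (B e / Z) +
     lam * ((n%:R * Z + I (fun x => l x * e x)) / Z - ln Z)) * I E =
     - s * I E + lam * (n%:R * I E - ln Z * I E).
    by rewrite /s; field; rewrite gt_eqF.
  rewrite L1 L2 in Hmax; rewrite /Phi; lra.
(* Since [I E (ln (I E) - ln Z) >= I E - Z], the entropy is at most the integral of
   [(u exp u - exp u + 1) e], which is quadratic in [t]. *)
have Hent := lne_sub_lower Zq0 Z0.
have Hquad : I (fun x => u x * E x) - (I E - Z) <= t ^+ 2 * I (fun x => h x ^+ 2 * e x).
  rewrite -(rintZ pI)//.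
  rewrite (_ : _ - _ = I (fun x => (-1) * (E x + (-1) * e x) + u x * E x)); last first.
    rewrite (rint_lin pI); [|by apply: bmD => //; exact: bmZ|exact: bmM].
    by rewrite (rintD pI)//; [rewrite (rintZ pI)//; ring|exact: bmZ].
  apply: (rint_le pI).
  - apply: bmD; last exact: bmM.
    by apply: bmZ; apply: bmD => //; exact: bmZ.
  - exact: bmZ.
  - move=> x Px; have u1 : u x <= 1 by have := u2 x Px; lra.
    have := mul_expR_sub_le_sqr u1 => /(ler_wpM2l (expR_ge0 (dotv x xi))).
    by rewrite Ee /u; lra.
have PhiE2 : Phi E <= t * Phi (fun x => h x * e x) +
    t ^+ 2 * (2 * pi * (2 * B (fun x => h x ^+ 2 * e x)) +
    W * (2 * I (fun x => h x ^+ 2 * e x))).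
  (* [r] is the Taylor remainder of [exp u], weighted by [e]; orders 0 and 1 contribute [Phi e = 0]
     and [t Phi(h e)]. *)
  pose r x := e x * (expR (u x) - 1 - u x).
  have br : bm P r.
    apply: bmM => //; apply: bmD; last by rewrite (_ : (fun x => - u x) = fun x => (-1) * u x); [exact: bmZ|apply/funext => x; rewrite mulN1r].
    by apply: bmD; [exact: bm_expR|exact: bm_cst].
  have -> : Phi E = t * Phi (fun x => h x * e x) + Phi r.
    rewrite -[RHS]add0r -Phie -Phi_lin// -[Phi e]mul1r -Phi_lin//; last first.
      by apply: bmD => //; exact: bmZ.
    by apply: eq_Phi => x _; rewrite Ee /r /u; ring.
  rewrite lerD2l.
  have r0 x : 0 <= r x.
    rewrite /r mulr_ge0 ?expR_ge0//; have := expR_ge1Dx (u x); lra.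
  have r2 x : P x -> r x <= (2 * t ^+ 2) * (h x ^+ 2 * e x).
    move=> Px; have := expR_le_quadratic (u2 x Px).
    move=> /(ler_wpM2l (expR_ge0 (dotv x xi))).
    by rewrite /r /u; lra.
  have Br : B r <= (2 * t ^+ 2) * B (fun x => h x ^+ 2 * e x).
    by rewrite -(rintZ pB)//; apply: (rint_le pB) => //; exact: bmZ.
  have Ir : - lam * I (fun x => l x * r x) - s * I r <=
      W * (2 * t ^+ 2) * I (fun x => h x ^+ 2 * e x).
    have -> : - lam * I (fun x => l x * r x) - s * I r =
        I (fun x => - lam * (l x * r x) + (- s) * r x).
      rewrite (rint_lin pI); [|exact: bmM|exact: bmZ].
      by rewrite (rintZ pI (- s) br); ring.
    rewrite -(rintZ pI)//; apply: (rint_le pI).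
    - by apply: bmD; apply: bmZ => //; exact: bmM.
    - exact: bmZ.
    - move=> x Px; have W0 : 0 <= W by rewrite (le_trans _ (WP x Px)).
      apply: (@le_trans _ _ (W * r x)).
        have -> : - lam * (l x * r x) + - s * r x = (- lam * l x - s) * r x by ring.
        by rewrite ler_wpM2r// (le_trans (ler_norm _))// WP.
      by rewrite -mulrA ler_wpM2l// r2.
  have pi0 : 0 <= 2 * pi :> R by rewrite mulr_ge0// pi_ge0.
  have := ler_wpM2l pi0 Br; rewrite /Phi.
  by lra.
have : lam * (t ^+ 2 * I (fun x => h x ^+ 2 * e x)) <=
    lam * (I (fun x => u x * E x) - I E * (ln (I E) - ln Z)).
  by rewrite ler_wnM2l//; lra.
have : 0 < t by [].
rewrite /K => _ Hlam.
rewrite -(pmulr_rge0 _ tt0).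
lra.
Qed.

(** * From semistability to the bound for an arbitrary competitor [q] *)

Section lsc_competitor.
Variable q : 'rV[R]_n -> \bar R.
Hypothesis qE1 : E1 P q.

Local Notation mu := (lebm R n).
Let E x := expeR (q x).
Let qNy x : P x -> q x != -oo%E := qE1.1 x.
Let lscE : lsc_on P E := lsc_expeR qNy qE1.2.1.
Let mE : measurable_fun P E := lsc_measurable lscE.
Let E0 x : (0 <= E x)%E := expeR_ge0 (q x).

Let Zq : R := fine (int_P P E).

Let Zq_def : int_P P E = Zq%:E.
Proof.
rewrite /Zq fineK// ge0_fin_numE; first exact: qE1.2.2.2.
by apply: (posint_ge0 pI).
Qed.

(** If finite somewhere, [exp q] attains its minimum on the compact [P], and this minimum is
    positive because [q] is never [-oo]. *)
Let Zq0 : 0 < Zq.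
Proof.
have [d d0 dE] : exists2 d : R, 0 < d & forall x, P x -> (d%:E <= E x)%E.
  have [ex|/forall2NP ny] := pselect (exists2 x, P x & (E x < +oo)%E).
    have [y Py [Ey ymin]] := lsc_compact_min cP lscE (fun x _ => E0 x) ex.
    exists (fine (E y)); last by move=> x Px; rewrite fineK// ymin.
    by rewrite -lte_fin fineK// expeR_gt0// ltNye qNy.
  exists 1 => // x Px; case: (ny x) => // /negP; rewrite -leNgt leye_eq => /eqP ->.
  by rewrite leey.
apply: (@lt_le_trans _ _ (d * I (fun=> 1))); first by rewrite mulr_gt0.
rewrite -lee_fin -Zq_def -(rintZ pI)//; last exact: bm_cst.
rewrite -(rintE pI); last by apply: bmZ; exact: bm_cst.
apply: (posint_le pI) => //.
- by move=> x Px; rewrite lee_fin mulr1 ltW.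
- by move=> x Px; rewrite mulr1 dE.
Qed.

Let mfE f : bm P f -> measurable_fun P (fun x => (f x)%:E * E x)%E.
Proof.
move=> [mf _]; apply: emeasurable_funM => //.
by apply/measurable_EFinP.
Qed.

Let intE : mu.-integrable P E.
Proof.
apply/integrableP; split=> //; under eq_integral do rewrite gee0_abs//.
by rewrite -int_PE// Zq_def ltry.
Qed.

Let intfE f : bm P f -> mu.-integrable P (fun x => (f x)%:E * E x)%E.
Proof.
move=> bf; have [M fM] := bf.2.
apply: (le_integrable mP (mfE bf) _ (integrableZl mP M intE)) => x Px.
rewrite !abseM lee_wpmul2r ?abse_ge0// lee_fin (le_trans (fM x Px))//.
exact: ler_norm.
Qed.

(* The shift [c] makes the weight nonnegative: products with the possibly
   infinite [E] distribute over sums of nonnegative reals only. *)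
Let c : R := sval (cid bl.2).
Let lc x := l x + c.
Let lc0 x : P x -> 0 <= lc x.
Proof.
move=> Px; have := svalP (cid bl.2) x Px; rewrite -/c ler_norml => /andP[+ _].
by rewrite /lc; lra.
Qed.
Let blc : bm P lc := bmD bl (bm_cst P c).

Let Lc : R := fine (\int[mu]_(x in P) ((lc x)%:E * E x))%E.
Let Lc_def : (\int[mu]_(x in P) ((lc x)%:E * E x))%E = Lc%:E.
Proof. by rewrite /Lc fineK// integrable_fin_num//; exact: intfE. Qed.

Let int_ZE k : (\int[mu]_(x in P) (k%:E * E x))%E = (k * Zq)%:E.
Proof. by rewrite (integralZl mP intE) -int_PE// Zq_def EFinM. Qed.

(** This is [Phi (exp q) >= 0], as [Lc - c Zq] is the integral of [l exp q]. *)
Let Fut_limit bq : toric_semistable P lam xi -> bd_int P E = bq%:E ->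
  0 <= 2 * pi * bq - lam * (Lc - c * Zq) - s * Zq.
Proof.
move=> ss bqE.
pose G x := expeR (q x + (- l x)%:E).
have GE x : (G x * (e x)%:E = E x)%E.
  rewrite /G /E -[(e x)%:E]/(expeR (l x)%:E) -expeRD -addeA -EFinD addNr.
  by rewrite adde0.
have lG : lsc_on P G.
  apply: lsc_expeR.
    by move=> x /qNy; case: (q x).
  apply: lsc_addr_continuous; first exact: qE1.2.1.
  by move=> x; apply: (@continuousN R R^o 'rV[R]_n (fun x => dotv x xi)); exact: dotv_continuous.
have cG : convex_on P G by apply: convex_expeR_sub => //; exact: qE1.2.2.1.
have [a [b [a0 b0 minor approx]]] := rat_affine_minorants cP
  (fun y z t => @conv_hull_convex _ _ S y z t) lG cG
  (fun y _ => expeR_ge0 (q y + (- l y)%:E)).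
pose h k := rplr (R := R) (fun i : 'I_k.+1 => a i) (fun i => b i).
have bh k : bm P (h k) by exact: bm_rplr.
have bhe k : bm P (fun x => h k x * e x) by exact: bmM.
have h0 k x : 0 <= h k x.
  have := rplr_ge (fun i : 'I_k.+1 => a i) (fun i => b i) x ord0.
  by rewrite /= a0 b0 map_mx0 dotvC dotv0l rmorph0 addr0.
have hG k x : P x -> ((h k x)%:E <= G x)%E.
  move=> Px; rewrite /h -rplE; apply/bigmax_leP; split; first exact: leNye.
  by move=> i _; exact: minor.
have heE k x : P x -> ((h k x * e x)%:E <= E x)%E.
  by move=> Px; rewrite -GE EFinM lee_wpmul2r ?hG// lee_fin expR_ge0.
have he_homo x : {homo (fun k => (h k x * e x)%:E) : k k' / (k <= k')%N >-> (k <= k')%E}.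
  move=> k k' kk'; rewrite lee_fin ler_wpM2r ?expR_ge0//.
  apply: rplr_le => i.
  exact: (rplr_ge (fun i : 'I_k'.+1 => a i) (fun i => b i) x
    (widen_ord (kk' : (k.+1 <= k'.+1)%N) i)).
have hlim x : P x -> limn (fun k => (h k x * e x)%:E) = E x.
  move=> Px; rewrite (cvg_lim _ (ereal_nondecreasing_cvgn (@he_homo x)))//.
  apply/le_anti/andP; split.
    by apply: ge_ereal_sup => _ [k _ <-]; exact: heE.
  rewrite leNgt; apply/negP => supE.
  (* A gap below [E x] forces the supremum to be finite; after division by [e x], [approx] yields a
     minorant exceeding it. *)
  have [r rE] : exists r : R, ereal_sup (range (fun k => (h k x * e x)%:E)) = r%:E.
    move: supE; have : (0%:E <= ereal_sup (range (fun k => (h k x * e x)%:E)))%E.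
      apply: (@le_trans _ _ (h 0%N x * e x)%:E).
        by rewrite lee_fin mulr_ge0// expR_ge0.
      by apply: ereal_sup_ubound; exists 0%N.
    case: ereal_sup => [r _ _|_|]; [by exists r|by rewrite ltNge leey|].
    by rewrite leNgt ltNy0.
  have ex0 : 0 < e x by exact: expR_gt0.
  have rG : ((r / e x)%:E < G x)%E.
    have G0 : (0 <= G x)%E by exact: expeR_ge0.
    move: supE; rewrite rE -GE; case: (G x) G0 => [g _| _|].
    - by rewrite -EFinM !lte_fin ltr_pdivrMr.
    - by rewrite ltry.
    - by rewrite leNgt ltNy0.
  have [i Ai] := approx x _ Px rG.
  have : (r%:E < (h i x * e x)%:E)%E.
    rewrite lte_fin -ltr_pdivrMr//; apply: (lt_le_trans Ai).
    exact: (rplr_ge (fun j : 'I_i.+1 => a j) (fun j => b j) x ord_max).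
  rewrite ltNge -rE; apply/negP; rewrite negbK.
  by apply: ereal_sup_ubound; exists i.
(* [C] makes [b1] nonnegative, so that [w] is a sum of two nonnegative terms and distributes over
   the possibly infinite [E]; [+ 1] allows division by [C]. *)
pose C := `|s| + `|lam * c| + 1.
pose b1 := C - s + lam * c.
have C0 : 0 < C by rewrite ltr_wpDl// addr_ge0.
have b10 : 0 <= b1.
  have := ler_norm s; have := ler_norm (- (lam * c)); rewrite normrN /b1 /C; lra.
pose w x := - lam * lc x + b1.
have bw : bm P w by apply: bmD; [exact: bmZ|exact: bm_cst].
have w0 x : P x -> 0 <= w x.
  by move=> /lc0 lx; rewrite addr_ge0// mulr_ge0// oppr_ge0.
pose X := 2 * pi * bq + (- lam * Lc + b1 * Zq).
have bound k : C * I (fun x => h k x * e x) <= X.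
  have : 0 <= Phi (fun x => h k x * e x).
    have := ss k (fun i => a i) (fun i => b i).
    rewrite (_ : rpl _ _ = fun x => (h k x)%:E); last by apply/funext => x; exact: rplE.
    by rewrite FutE// lee_fin pmulr_lge0// invr_gt0.
  have -> : Phi (fun x => h k x * e x) = 2 * pi * B (fun x => h k x * e x) +
      (I (fun x => w x * (h k x * e x)) - C * I (fun x => h k x * e x)).
    rewrite /Phi (_ : I (fun x => w x * (h k x * e x)) =
      - lam * I (fun x => l x * (h k x * e x)) + (C - s) * I (fun x => h k x * e x)).
      by ring.
    rewrite -(rintZ pI (C - s) (bhe k)) -(rint_lin pI); [|exact: bmM|exact: bmZ].
    by apply: (eq_rint pI) => x _; rewrite /w /lc /b1; ring.
  have : B (fun x => h k x * e x) <= bq.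
    rewrite -lee_fin -(rintE pB)// -bqE; apply: (posint_le pB) => //.
    - by apply/measurable_EFinP; exact: (bhe k).1.
    - by move=> x Px; rewrite lee_fin mulr_ge0// expR_ge0.
    - by move=> x; exact: heE.
  have : I (fun x => w x * (h k x * e x)) <= - lam * Lc + b1 * Zq.
    rewrite -lee_fin -(rintE pI); last exact: bmM.
    apply: (@le_trans _ _ (int_P P (fun x => (w x)%:E * E x)%E)).
      apply: (posint_le pI).
      - by apply/measurable_EFinP; exact: (bmM bw (bhe k)).1.
      - exact: mfE.
      - by move=> x Px; rewrite lee_fin mulr_ge0 ?w0// mulr_ge0// expR_ge0.
      - by move=> x Px; rewrite EFinM lee_wpmul2l ?heE// lee_fin w0.
    rewrite int_PE; last exact: mfE.
    rewrite (eq_integral (fun x => (- lam)%:E * ((lc x)%:E * E x) + b1%:E * E x)%E);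
      last first.
      move=> x /set_mem Px; rewrite /w EFinD ge0_muleDl.
      - by rewrite EFinM muleA.
      - by rewrite lee_fin mulr_ge0 ?oppr_ge0// lc0.
      - by rewrite lee_fin.
    rewrite (integralD mP); [|exact/integrableZl/intfE|exact: integrableZl].
    by rewrite (integralZl mP (intfE blc)) Lc_def int_ZE -EFinM -EFinD.
  have pi0 : 0 <= 2 * pi :> R by rewrite mulr_ge0// pi_ge0.
  move=> H1 /(ler_wpM2l pi0) H2; rewrite /X; lra.
(* The only passage to the limit. After unfolding [X] and [b1], the terms in [C] cancel and the
   claim remains. *)
have : Zq <= X / C.
  rewrite -lee_fin -Zq_def int_PE//.
  rewrite (eq_integral (fun x => limn (fun k => (h k x * e x)%:E))); last first.
    by move=> x /set_mem Px; rewrite hlim.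
  rewrite (@monotone_convergence _ _ _ mu P mP (fun k x => (h k x * e x)%:E)).
  - apply: lime_le.
      apply: ereal_nondecreasing_is_cvgn => k k' kk'.
      apply: ge0_le_integral => //.
      + by move=> x Px; rewrite lee_fin mulr_ge0// expR_ge0.
      + by apply/measurable_EFinP; exact: (bhe k).1.
      + by apply/measurable_EFinP; exact: (bhe k').1.
      + by move=> x Px; exact: he_homo.
    apply: nearW => k; rewrite -int_PE; last first.
      by apply/measurable_EFinP; exact: (bhe k).1.
    by rewrite (rintE pI)// lee_fin ler_pdivlMr// mulrC.
  - by move=> k; apply/measurable_EFinP; exact: (bhe k).1.
  - by move=> k x Px; rewrite lee_fin mulr_ge0// expR_ge0.
  - by move=> x Px; exact: he_homo.
by rewrite ler_pdivlMr// /X /b1; lra.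
Qed.

(* Gibbs' inequality, integrated from
   [e^r (1 + l + d - r) <= e^(l + d)] with [e^d = Zq / Z]. *)
Let entropy_lower :
  ((Lc - c * Zq + (n%:R + ln Zq - ln Z) * Zq)%:E <=
    int_P P (fun x => ((n%:R)%:E + q x) * E x))%E.
Proof.
pose d := ln Zq - ln Z.
have edZ : expR d * Z = Zq by rewrite /d expRD expRN !lnK// divfK// gt_eqF.
have mq : measurable_fun P q by apply: lsc_measurable; exact: qE1.2.1.
have mf : measurable_fun P (fun x => ((n%:R)%:E + q x) * E x)%E.
  by apply: emeasurable_funM => //; apply: emeasurable_funD.
(* [- c] undoes the shift in [lc]; the contribution of [+ 1] is [Zq], which cancels the integral of
   [exp d e]. *)
pose k := n%:R + d + 1 - c.
pose f x := ((lc x)%:E * E x + (k%:E * E x + (- expR d * e x)%:E))%E.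
have ie : mu.-integrable P (fun x => (- expR d * e x)%:E).
  have [me [M eM]] := bmZ (- expR d) be.
  apply: measurable_bounded_integrable => //; first exact: lebm_compact.
  exists M; split; first by rewrite num_real.
  by move=> y My x Px; apply: le_trans (ltW My); exact: eM.
have ik : mu.-integrable P (fun x => k%:E * E x)%E by exact: integrableZl.
have ikD : mu.-integrable P (fun x => k%:E * E x + (- expR d * e x)%:E)%E.
  exact: (integrableD mP ik ie).
have ilE := intfE blc.
rewrite int_PE//; apply: (@le_trans _ _ (\int[mu]_(x in P) f x)%E); last first.
  apply: measurable_le_integral => //.
    exact: (measurable_int mu (integrableD mP ilE ikD)).
  move=> x Px; rewrite /f /E; have := qNy Px.
  case: (q x) => [r| |]// _; last by rewrite /= gt0_mulye ?leey.
  rewrite /= lee_fin.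
  have := expR_ge1Dx (l x + d - r).
  move=> /(ler_wpM2l (expR_ge0 r)); rewrite -expRD subrKC expRD /lc /k.
  by lra.
rewrite /f (integralD mP ilE ikD) (integralD mP ik ie) Lc_def int_ZE.
rewrite -int_PE; last by apply/measurable_EFinP; exact: (bmZ (- expR d) be).1.
rewrite (rintE pI (bmZ (- expR d) be)) (rintZ pI)// mulNr edZ -!EFinD lee_fin.
by rewrite /k /d; lra.
Qed.

Lemma toric_semistable_le_maximum : toric_semistable P lam xi ->
  (muNA_lam P lam q <= muNA_lam P lam (fun x => (dotv x xi)%:E))%E.
Proof.
move=> ss; rewrite (muNA_lamE bl) /muNA_lam /muNA /sigmaNA -/E -/Zq.
have := entropy_lower; rewrite -/E.
(* [entropy_lower] excludes [-oo], and [+oo] makes the entropy infinite, where [muNA_lam] is [-oo]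
   by definition. In the finite case the entropy bound, reversed by [lam <= 0], is added to
   [Fut_limit]. *)
case: (int_P P _) => [v| |]; last by rewrite leeNy_eq.
- rewrite lee_fin => vle; case: ifPn => _; last by rewrite leNye.
  have Zqi : 0 < Zq^-1 by rewrite invr_gt0.
  have := posint_ge0 pB mE (fun x _ => E0 x); case bqE : (bd_int P E) => [bq| |]//.
    move=> _; have Hb := Fut_limit ss bqE.
    rewrite -!(EFinM, EFinB, EFinD) lee_fin.
    have Il : I (fun x => (n%:R + l x) * e x) = n%:R * Z + I (fun x => l x * e x).
      rewrite -(rint_lin pI)//; last exact: bmM.
      by apply: (eq_rint pI) => x _; ring.
    rewrite Il -(ler_pM2r Zq0).
    have -> : (- (2 * pi) * (bq / Zq) + lam * (v / Zq - ln Zq)) * Zq =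
      - (2 * pi) * bq + lam * (v - ln Zq * Zq) by field; rewrite gt_eqF.
    have -> : (- (2 * pi) * (B e / Z) +
      lam * ((n%:R * Z + I (fun x => l x * e x)) / Z - ln Z)) * Zq =
      - s * Zq + lam * (n%:R * Zq - ln Z * Zq).
      by rewrite /s; field; rewrite gt_eqF.
    by move: (ler_wnM2l hlam vle); lra.
  (* Infinite boundary integral: [muNA] is [-oo], and the finite entropy term cannot compensate. *)
  move=> _; rewrite gt0_mulye ?lte_fin// lt0_muley ?addNye ?leNye//.
  by rewrite lte_fin oppr_lt0 mulr_gt0// pi_gt0.
- move=> _; rewrite gt0_mulye ?lte_fin ?invr_gt0// addye//.
  by rewrite ltxx leNye.
Qed.

End lsc_competitor.

End semistability.

(* (X, L) is encoded by its moment lattice polytope P = conv S, S a finite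
   set of lattice points of M = Z^n with conv S of nonempty interior. *)
Theorem mainTheorem15 (R : realType) (n : nat) (S : seq 'rV[R]_n)
    (HS : forall s, s \in S -> is_lattice s)
    (Hint : interior (conv_hull S) !=set0)
    (lam : R) (hlam : lam <= 0) (xi : 'rV[R]_n) :
  toric_semistable (conv_hull S) lam xi <->
  (forall q : 'rV[R]_n -> \bar R, E1 (conv_hull S) q ->
     (muNA_lam (conv_hull S) lam q
      <= muNA_lam (conv_hull S) lam (fun x => (dotv x xi)%:E))%E).
Proof.
split; first by move=> ss q qE1; exact: toric_semistable_le_maximum.
exact: maximizer_toric_semistable.
Qed.
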